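(* For every double star $H$, there is a polynomial $f$ such that $\chi(G)\le f(\omega(G))$ for every $H$-free graph $G$.
   Context: All graphs are finite and simple. $\chi(G)$ and $\omega(G)$ denote the chromatic number and the clique number of $G$. A double star is a tree in which at most two vertices have degree more than one. A graph $G$ is $H$-free if no induced subgraph of $G$ is isomorphic to $H$. *)

(* Defs.v *)
From mathcomp Require Import all_boot.

Set Implicit Arguments.
Unset Strict Implicit.
Unset Printing Implicit Defensive.

Record sgraph := SGraph {
  vertex :> finType;
  adj : rel vertex;
  adj_sym : symmetric adj;
  adj_irrefl : irreflexive adj
}.

Section Graph.
Variable G : sgraph.

Definition proper_coloring k (c : {ffun G -> 'I_k}) : bool :=
  [forall x, forall y, adj x y ==> (c x != c y)].

Definition colorable k : bool :=
  [exists c : {ffun G -> 'I_k}, proper_coloring c].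

Lemma colorable_ex : exists k, colorable k.
Proof.
exists #|G|; apply/existsP; exists [ffun x => enum_rank x].
apply/forallP => x; apply/forallP => y; apply/implyP => xy.
rewrite !ffunE (inj_eq enum_rank_inj).
by apply: contraTneq xy => ->; rewrite adj_irrefl.
Qed.

Definition chromatic_number : nat := ex_minn colorable_ex.

Definition is_clique (S : {set G}) : bool :=
  [forall x in S, forall y in S, (x != y) ==> adj x y].

Definition clique_number : nat := \max_(S : {set G} | is_clique S) #|S|.

Definition degree (x : G) : nat := #|[set y | adj x y]|.

(* The null graph is not considered connected, so trees are nonempty. *)
Definition connected_graph : Prop :=
  0 < #|G| /\ forall x y : G, connect (@adj G) x y.

(* The size bound excludes the ucycles [::] and [:: x; y] (for an edge xy),
   which are not graph cycles. *)
Definition acyclic_graph : Prop :=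
  forall c : seq G, 2 < size c -> ~ ucycle (@adj G) c.

Definition is_tree : Prop := connected_graph /\ acyclic_graph.

Definition double_star : Prop :=
  is_tree /\ #|[set x : G | 1 < degree x]| <= 2.

Section Induced.
Variable S : {set G}.

Definition induced_adj : rel {x : G | x \in S} :=
  fun x y => adj (val x) (val y).

Lemma induced_sym : symmetric induced_adj.
Proof. by move=> x y; apply: adj_sym. Qed.

Lemma induced_irrefl : irreflexive induced_adj.
Proof. by move=> x; apply: adj_irrefl. Qed.

Definition induced : sgraph := SGraph induced_sym induced_irrefl.

End Induced.
End Graph.

Definition isomorphic (G H : sgraph) : Prop :=
  exists f : G -> H, bijective f /\ forall x y, adj (f x) (f y) = adj x y.

Definition graph_free (H G : sgraph) : Prop :=
  forall S : {set G}, ~ isomorphic (induced S) H.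

(* Main.v *)
Require Import Defs.
From mathcomp Require Import all_boot all_order all_algebra.
From mathcomp Require Import zify.

(** A double star is an induced subgraph of a balanced one, with [d] leaves at
    each of two adjacent centres, so it is enough to colour the graphs [G] of
    clique number at most [k] that contain no balanced double star
    ([free_double_star_free]).  For [d = 1] these are the cographs, whose
    chromatic and clique numbers agree, because a connected cograph is the join
    of two smaller ones and clique numbers add up over joins.  The proof is an
    approximate version of this argument, in which every error term is
    polynomial in [k].

    The role of Ramsey's theorem is that any [m] vertices contain a stable
    [d]-set, with [m] polynomial in [k].  Call a neighbour of [x] private
    against [y] if it is neither [y] nor a neighbour of [y].  For adjacent [x]
    and [y], two anticomplete sets of private neighbours, one of [x] against [y]
    and one of [y] against [x], cannot both have [m] elements ([few_private]).
    Consequently, all but polynomially many vertices are adjacent to a given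
    small set [U] of vertices as in a cograph, with errors below [m]
    ([exceptional_ex]).

    A template is a family of bounded vertex sets, its parts, that are almost
    complete to each other and such that no part is almost the join of two
    smaller sets.  Large minimum degree yields a template with two parts
    ([rich_edge], [template_start]); there are at most [k] parts, as a clique
    can be chosen across them ([template_le]); and if many vertices are almost
    complete to every part, then they contain one more part ([core_extend]).  In
    a template that cannot be extended, an unexceptional vertex outside a small
    set therefore either misses almost all of every part (it is far) or is
    almost complete to some parts but not to all (it is in the middle).  The
    sets of parts missed by middle vertices form a laminar family
    ([missed_laminar]).  A maximal member of this family cuts the parts in two
    groups so that each middle vertex is almost complete to one of the groups.
    This divides the middle vertices in two classes, which are almost complete
    to each other, so their clique numbers are below [k] and add up to at most
    [k] ([mid_split]).

    Middle and far vertices interact little: a far vertex with a neighbour in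
    the middle has few far neighbours ([far_degree]).  In a minimal
    counterexample for a bound [f], the graph without the middle vertices has a
    colouring with [f k] colours.  The far vertices that have middle neighbours
    can be recoloured with few colours, so that few colours occur on the
    neighbourhood of the middle, and the other colours suffice for the middle as
    soon as [f a + f b + loss k <= f k] whenever [a + b <= k] and [a, b < k]
    ([colours_of_template]).  If [loss k <= B * k ^ e.+1], then
    [f k = B * k ^ e.+2] satisfies this inequality ([pow_slack]). *)

Set Implicit Arguments.
Unset Strict Implicit.
Unset Printing Implicit Defensive.

Import Order.TTheory GRing.Theory Num.Theory.

(** * Neighbourhoods, cliques and near-complete pairs *)

Lemma card_bigcup_le (I T : finType) (Q : {set I}) (F : I -> {set T}) b :
  (forall q, q \in Q -> #|F q| <= b) -> #|\bigcup_(q in Q) F q| <= #|Q| * b.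
Proof.
move=> hF; rewrite -sum_nat_const.
apply: (@leq_trans (\sum_(q in Q) #|F q|)); last exact: leq_sum.
elim/big_rec2: _ => [|q n A _ le_A]; first by rewrite cards0.
by rewrite (leq_trans (leq_card_setU _ _)) // leq_add2l.
Qed.

Lemma subset_of_card (T : finType) (A : {set T}) n :
  n <= #|A| -> exists2 B : {set T}, B \subset A & #|B| = n.
Proof.
move=> le_nA; exists [set x in take n (enum A)].
  by apply/subsetP=> x; rewrite inE => /mem_take; rewrite mem_enum.
rewrite cardsE (card_uniqP _) ?take_uniq ?enum_uniq //.
by rewrite size_take -cardE; case: ltngtP le_nA.
Qed.

Lemma card_minus (T : finType) (A B : {set T}) c :
  #|A :&: B| <= c -> #|A| <= c + #|A :\: B|.
Proof. by move=> le_c; rewrite -(cardsID B A) leq_add2r. Qed.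

Lemma card_inter (T : finType) (A B : {set T}) c :
  #|A :\: B| <= c -> #|A| <= c + #|A :&: B|.
Proof. by move=> le_c; rewrite -(cardsID B A) addnC leq_add2r. Qed.

Lemma card_subset_le (T : finType) (A B : {set T}) c :
  A \subset B -> #|B| <= c -> #|A| <= c.
Proof. by move/subset_leq_card/leq_trans; apply. Qed.

Section Graph.
Variable G : sgraph.
Implicit Types (x y u v w l i : G) (A B P Q R S U X Y Z : {set G}).

(** Locked, so that the simplification of memberships in set expressions
    stops at neighbourhoods. *)
Fact nbrs_key : unit. Proof. by []. Qed.
Definition nbrs x : {set G} := locked_with nbrs_key [set y | adj x y].
Definition priv x y := nbrs x :\: (y |: nbrs y).
Definition anticomplete A B := [forall a in A, forall b in B, ~~ adj a b].
Definition stable A := anticomplete A A.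
(** This relation is not symmetric: a vertex of [B] may be nonadjacent to many
    vertices of [A]. *)
Definition near b A B := [forall a in A, #|B :\: nbrs a| <= b].

Lemma in_nbrs x y : (y \in nbrs x) = adj x y.
Proof. by rewrite /nbrs locked_withE inE. Qed.

Lemma nbrs_sym x y : (y \in nbrs x) = (x \in nbrs y).
Proof. by rewrite !in_nbrs adj_sym. Qed.

Lemma in_priv x y z : (z \in priv x y) = [&& z != y, z \notin nbrs y & z \in nbrs x].
Proof. by rewrite !inE negb_or -andbA. Qed.

Lemma anticompleteP A B :
  reflect {in A & B, forall a b, a \notin nbrs b} (anticomplete A B).
Proof.
apply: (iffP forall_inP) => [h a b aA bB | h a aA].
  by have /forall_inP/(_ b bB) := h a aA; rewrite in_nbrs adj_sym.
by apply/forall_inP=> b bB; have := h a b aA bB; rewrite in_nbrs adj_sym.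
Qed.

Lemma anticompleteS A B A' B' :
  A' \subset A -> B' \subset B -> anticomplete A B -> anticomplete A' B'.
Proof.
move=> /subsetP sA /subsetP sB /anticompleteP h; apply/anticompleteP=> a b.
by move=> /sA aA /sB bB; apply: h.
Qed.

Lemma nearP b A B :
  reflect {in A, forall a, #|B :\: nbrs a| <= b} (near b A B).
Proof. exact: forall_inP. Qed.

Lemma nearS b A B A' B' :
  A' \subset A -> B' \subset B -> near b A B -> near b A' B'.
Proof.
move=> /subsetP sA sB /nearP h; apply/nearP=> a /sA /h.
by apply: leq_trans; rewrite subset_leq_card // setSD.
Qed.

Lemma near_le b c A B : b <= c -> near b A B -> near c A B.
Proof. by move=> bc /nearP h; apply/nearP=> a /h /leq_trans; apply. Qed.

Lemma common_nbrs A Q b : {in Q, forall q, #|A :\: nbrs q| <= b} ->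
  #|A| <= #|[set a in A | Q \subset nbrs a]| + #|Q| * b.
Proof.
move=> hQ; have := card_bigcup_le hQ.
set D := \bigcup_(q in Q) _ => leD.
apply: (@leq_trans (#|[set a in A | Q \subset nbrs a] :|: D|)); last first.
  by rewrite (leq_trans (leq_card_setU _ _)) // leq_add2l.
apply/subset_leq_card/subsetP=> a aA; rewrite !inE aA /=.
case: (boolP (Q \subset nbrs a)) => //= /subsetPn[q qQ qa].
by apply/bigcupP; exists q => //; rewrite !inE aA andbT nbrs_sym.
Qed.

Definition nbrs_of Q := \bigcup_(q in Q) nbrs q.

Lemma card_meet_nbrs_of A Q b : {in Q, forall q, #|A :&: nbrs q| <= b} ->
  #|A :&: nbrs_of Q| <= #|Q| * b.
Proof.
move=> hQ; apply: leq_trans (card_bigcup_le hQ); apply/subset_leq_card.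
by apply/subsetP=> x /setIP[xA /bigcupP[q qQ xq]]; apply/bigcupP; exists q; rewrite // inE xA.
Qed.

Lemma notin_nbrs_of Q x q : x \notin nbrs_of Q -> q \in Q -> x \notin nbrs q.
Proof. by move=> /bigcupP xQ qQ; apply/negP=> xq; apply: xQ; exists q. Qed.

Lemma is_cliqueP Q :
  reflect {in Q &, forall x y, x != y -> y \in nbrs x} (is_clique Q).
Proof.
apply: (iffP forall_inP) => [h x y xQ yQ xy|h x xQ].
  by have /forall_inP/(_ y yQ)/implyP/(_ xy) := h x xQ; rewrite in_nbrs.
by apply/forall_inP=> y yQ; apply/implyP=> /(h x y xQ yQ); rewrite in_nbrs.
Qed.

Lemma clique_setU Q Q' : is_clique Q -> is_clique Q' ->
  {in Q & Q', forall x y, y \in nbrs x} -> is_clique (Q :|: Q').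
Proof.
move=> /is_cliqueP cQ /is_cliqueP cQ' QQ'; apply/is_cliqueP=> x y.
rewrite !inE => /orP[xQ|xQ'] /orP[yQ|yQ'] xy; [exact: cQ|exact: QQ'| |exact: cQ'].
by rewrite nbrs_sym QQ'.
Qed.

Lemma clique_setU1 v Q : is_clique Q -> Q \subset nbrs v -> is_clique (v |: Q).
Proof.
move=> cQ /subsetP sQ; apply: clique_setU => //.
  by apply/is_cliqueP=> x y /set1P-> /set1P->; rewrite eqxx.
by move=> x y /set1P-> /sQ.
Qed.

Lemma nbrs_irr x : x \notin nbrs x. Proof. by rewrite in_nbrs adj_irrefl. Qed.

Section CliqueBound.
Variable k : nat.
Hypothesis clique_le : forall Q, is_clique Q -> #|Q| <= k.

(** A clique with one vertex in each set is chosen from the last set backwards: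
    the vertices chosen so far miss, together, fewer vertices of the next set than
    it has.  Every bound by [k] on a number of sets comes from this. *)
Lemma clique_transversal b (s : seq {set G}) :
  pairwise (fun A B => near b B A) s -> all (fun A : {set G} => b * size s < #|A|) s ->
  size s <= k.
Proof.
move=> ps big.
suff aux n : size s <= n -> all (fun A : {set G} => b * n < #|A|) s ->
    exists Q, [/\ is_clique Q, #|Q| = size s &
    {in Q, forall q, exists2 B, B \in s & q \in B}].
  by have [Q [cQ <- _]] := aux _ (leqnn _) big; apply: clique_le.
move=> le_n {}big.
elim: s ps le_n big => [|A s IHs] /=.
  move=> _ _ _; exists set0; rewrite cards0; split=> // [|q]; last by rewrite inE.
  by apply/is_cliqueP => x; rewrite inE.
case/andP=> /allP nA ps lt_n /andP[bigA big].
have [Q [cQ sQ inQ]] := IHs ps (ltnW lt_n) big.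
have /common_nbrs : {in Q, forall q, #|A :\: nbrs q| <= b}.
  by move=> q /inQ[B Bs qB]; move/nearP: (nA B Bs); apply.
case: (set_0Vmem [set a in A | Q \subset nbrs a]) => [->|[v]].
  rewrite cards0 sQ; move: (leq_mul (leqnn b) (ltnW lt_n)); lia.
rewrite inE => /andP[vA Qv] _; exists (v |: Q); split.
- exact: clique_setU1.
- rewrite cardsU1 sQ; case: (boolP (v \in Q)) => // /(subsetP Qv).
  by rewrite (negPf (nbrs_irr v)).
move=> q /setU1P[->|/inQ[B Bs qB]]; first by exists A; rewrite ?mem_head.
by exists B => //; rewrite inE Bs orbT.
Qed.

(** Otherwise [k.+1] copies of [A] contradict [clique_transversal]. *)
Lemma many_nonnbrs A b : k.+1 * b < #|A| -> exists2 v, v \in A & b < #|A :\: nbrs v|.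
Proof.
move=> bigA; apply/exists_inP; apply: contraTT isT => /exists_inPn small.
suff: size (nseq k.+1 A) <= k by rewrite size_nseq ltnn.
apply: (@clique_transversal b); last by apply/allP=> B; rewrite size_nseq => /nseqP[-> _]; lia.
have nA : near b A A by apply/nearP=> a /small; rewrite -leqNgt.
by elim: k.+1 => //= n ->; rewrite andbT all_nseq nA orbT.
Qed.

(** Ramsey's theorem with a bound polynomial in [k]: a vertex with many
    nonneighbours in [A] is kept and its neighbours are discarded, [d] times. *)
Lemma stable_subset d A : k.+2 ^ d <= #|A| ->
  exists I : {set G}, [/\ I \subset A, #|I| = d & stable I].
Proof.
elim: d A => [|d IHd] A bigA.
  exists set0; rewrite sub0set cards0; split=> //.
  by apply/anticompleteP => x y; rewrite inE.
have [|v vA] := @many_nonnbrs A (k.+2 ^ d).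
  by apply: leq_trans bigA; rewrite expnS ltn_pmul2r ?expn_gt0.
rewrite (cardsD1 v) !inE vA nbrs_irr /= => /IHd[I [/subsetP sI cI stI]].
have inI y : y \in I -> [/\ y != v, y \notin nbrs v & y \in A].
  by move/sI; rewrite !inE => /and3P[].
exists (v |: I); split.
- by apply/subsetP=> y /setU1P[->//|/inI[]].
- by rewrite cardsU1 cI; case: (boolP (v \in I)) => // /inI[]; rewrite eqxx.
have vI y : y \in I -> y \notin nbrs v by case/inI.
apply/anticompleteP => x y /setU1P[->|xI] /setU1P[->|yI].
- exact: nbrs_irr.
- by rewrite nbrs_sym vI.
- exact: vI.
- by move/anticompleteP: stI; apply.
Qed.

(** The number [a] is a robust clique number of [Y], namely the largest size such
    that [Y] contains [M] disjoint cliques of that size.  Their union [A] still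
    contains one of them after the deletion of fewer than [M] vertices, and [R] is
    a maximal union of disjoint cliques of size [a.+1]. *)
Lemma clique_packing Y M : 0 < M -> exists a A R,
  [/\ a <= k, A \subset Y, #|A| <= a * M,
      forall S, #|S| < M -> exists Q, [/\ is_clique Q, Q \subset A :\: S & #|Q| = a]
    & #|R| <= a.+1 * M /\ forall Q, Q \subset Y :\: R -> is_clique Q -> #|Q| <= a].
Proof.
move=> Mpos.
pose packs b M' A := [/\ A \subset Y, #|A| <= b * M' & forall S, #|S| < M' ->
  exists Q, [/\ is_clique Q, Q \subset A :\: S & #|Q| = b]].
have clq0 : is_clique (set0 : {set G}) by apply/is_cliqueP=> x; rewrite inE.
have packs_or_hit b M' : (exists A, packs b M' A) \/ exists R : {set G}, #|R| <= b * M' /\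
    forall Q, Q \subset Y :\: R -> is_clique Q -> #|Q| < b.
  elim: M' => [|M' [[A [sA cA pA]]|[R [cR hR]]]].
  - by left; exists set0; rewrite /packs sub0set cards0; split.
  - have [|] := boolP [exists Q : {set G}, [&& is_clique Q, Q \subset Y :\: A & #|Q| == b]];
      last first.
      move/existsPn=> noQ; right; exists A.
      split; first by rewrite mulnS (leq_trans cA) ?leq_addl.
      move=> Q sQ cQ; rewrite ltnNge; apply/negP=> /subset_of_card[Q' sQ' cQ'].
      have /negP[] := noQ Q'; rewrite cQ' eqxx (subset_trans sQ' sQ) !andbT.
      apply/is_cliqueP=> x y xQ yQ; move/is_cliqueP: cQ; apply; exact: (subsetP sQ').
    case/existsP=> Q /and3P[cQ sQ /eqP bQ]; left; exists (A :|: Q); split.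
    + by rewrite subUset sA (subset_trans sQ) ?subsetDl.
    + by rewrite (leq_trans (leq_card_setU _ _)) // bQ mulnS addnC leq_add.
    move=> S; rewrite ltnS => cS; have [QS|/set0Pn[x xQS]] := eqVneq (Q :&: S) set0.
      exists Q; split=> //; apply/subsetP=> x xQ; rewrite !inE xQ orbT andbT.
      by apply/negP=> xS; have : x \in Q :&: S; [rewrite inE xQ | rewrite QS inE].
    have [|Q' [cQ' sQ' bQ']] := pA (S :\: Q).
      apply: leq_trans cS; rewrite -(cardsID Q S) -[X in X < _]add0n ltn_add2r.
      by apply/card_gt0P; exists x; rewrite setIC.
    exists Q'; split=> //; apply/subsetP=> y yQ'; have := subsetP sQ' y yQ'.
    rewrite !inE => /andP[yS yA]; rewrite yA andbT; move: yS.
    have : y \notin Q; last by move=> /negPf->.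
    by apply/negP=> /(subsetP sQ); rewrite inE yA.
  - right; exists R; split=> //; by rewrite mulnS (leq_trans cR) ?leq_addl.
suff IH j a : a + j = k -> (exists A, packs a M A) -> exists a A R,
  [/\ a <= k, A \subset Y, #|A| <= a * M,
      forall S, #|S| < M -> exists Q, [/\ is_clique Q, Q \subset A :\: S & #|Q| = a]
    & #|R| <= a.+1 * M /\ forall Q, Q \subset Y :\: R -> is_clique Q -> #|Q| <= a].
  apply: (IH k 0) => //; exists set0; rewrite /packs sub0set cards0; split=> // S _.
  by exists set0; rewrite sub0set cards0.
elim: j a => [|j IHj] a ajk [A [sA cA pA]].
all: have [|[R [cR hR]]] := packs_or_hit a.+1 M; last by exists a, A, R; split=> //; lia.
  case=> A' [_ _ /(_ set0)]; rewrite cards0 => /(_ Mpos)[Q [cQ _ bQ]].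
  by have := clique_le cQ; rewrite bQ -ajk addn0 ltnn.
by apply: IHj; rewrite addSnnS.
Qed.

End CliqueBound.
End Graph.

(** * Private neighbourhoods and exceptional vertices *)

(** No induced subgraph is a balanced double star with centres [x], [y] and
    leaves [A], [B]. *)
Definition double_star_free d (G : sgraph) := forall (x y : G) (A B : {set G}),
  y \in nbrs x -> #|A| = d -> #|B| = d -> A \subset priv x y ->
  B \subset priv y x -> ~~ stable (A :|: B).

Lemma stable_setU (G : sgraph) (A B : {set G}) :
  stable A -> stable B -> anticomplete A B -> stable (A :|: B).
Proof.
move=> /anticompleteP sA /anticompleteP sB /anticompleteP sAB.
apply/anticompleteP=> x y /setUP[xA|xB] /setUP[yA|yB]; [exact: sA|exact: sAB| |exact: sB].
by rewrite nbrs_sym sAB.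
Qed.

Lemma bin_le_exp a n e : a <= n -> 'C(a, e) <= n ^ e.
Proof.
move=> le_an; apply: (@leq_trans (a ^_ e)); first by rewrite -bin_ffact leq_pmulr ?fact_gt0.
elim: e => // e IHe; rewrite ffactnSr expnSr leq_mul //.
by rewrite (leq_trans (leq_subr _ _)).
Qed.

Section Exceptional.
Variables (G : sgraph) (d m : nat).
Implicit Types (x y u v w l i : G) (A B I J P Q R S U W X Z : {set G}).
Hypothesis ramsey : forall A, m <= #|A| ->
  exists I : {set G}, [/\ I \subset A, #|I| = d & stable I].
Hypothesis dsf : double_star_free d G.

(** A stable [d]-subset of [W] would complete [u], [v] and [J] to an induced
    double star. *)
Lemma few_private_stable u v J W : v \in nbrs u -> J \subset priv u v -> #|J| = d ->
  stable J -> W \subset priv v u -> anticomplete J W -> #|W| < m.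
Proof.
move=> uv sJ cJ stJ sW JW; rewrite ltnNge; apply/negP.
case/ramsey=> I [sI cI stI].
have /negP[] := dsf uv cJ cI sJ (subset_trans sI sW).
by apply: stable_setU stJ stI (anticompleteS _ sI JW).
Qed.

Lemma few_private u v A B : v \in nbrs u -> A \subset priv u v -> B \subset priv v u ->
  anticomplete A B -> m <= #|A| -> #|B| < m.
Proof.
move=> uv sA sB AB /ramsey[J [sJ cJ stJ]].
apply: few_private_stable uv (subset_trans sJ sA) cJ stJ sB _.
exact: anticompleteS AB.
Qed.

(** Exceptional vertices will be those that lie in an atom with few elements, for
    [l], [i] and the [d]-set [J] taken in [U]. *)
Definition atom U l i J : {set G} :=
  [set w | [&& w \notin U, l \in nbrs w, i \notin nbrs w & J \subset ~: nbrs w]].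

Lemma atomP U l i J w :
  reflect [/\ w \notin U, l \in nbrs w, i \notin nbrs w & {in J, forall z, z \notin nbrs w}]
          (w \in atom U l i J).
Proof.
rewrite [w \in atom _ _ _ _]inE; apply: (iffP idP) => [/and4P[wU lw iw sJ]|[wU lw iw sJ]].
  split=> // z /(subsetP sJ); by rewrite inE.
by rewrite wU lw iw; apply/subsetP=> z /sJ; rewrite inE.
Qed.

Lemma atom_priv U l i J : i \in U -> atom U l i J \subset priv l i.
Proof.
move=> iU; apply/subsetP=> w /atomP[wU lw iw _].
rewrite in_priv [w \in nbrs l]nbrs_sym lw [w \in nbrs i]nbrs_sym iw andbT andbT.
by apply: contraNneq wU => ->.
Qed.

Lemma atom_anti U l i J : anticomplete J (atom U l i J).
Proof. by apply/anticompleteP=> z w zJ /atomP[_ _ _]; apply. Qed.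

(** In a cograph both sets below are empty.  For [z] in the first set,
    [w - l - i - z] would be an induced path.  For [z] in the second set, the
    induced path would be [w - l - i - w'] or, if [w] and [w'] are adjacent,
    [z - l - w - w']. *)
Definition exceptional U X :=
  [/\ U \subset X,
      forall w l i, w \notin X -> l \in U -> i \in U -> i \in nbrs l ->
        l \in nbrs w -> i \notin nbrs w -> #|(U :&: nbrs i) :\: nbrs l :\: nbrs w| < m
    & forall w w' l i, w \notin X -> w' \notin X -> l \in U -> i \in U -> i \in nbrs l ->
        l \in nbrs w -> i \notin nbrs w -> l \notin nbrs w' -> i \in nbrs w' ->
        #|(U :&: nbrs l :&: nbrs i) :\: nbrs w :\: nbrs w'| < m].

(** The set [U] itself, and for all [l], [i] in [U] and every [d]-subset of [U] an
    atom with fewer than [m * m + m] elements. *)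
Definition exc_bound n := n + n * (n * (n ^ d * (m * m + m))).

(** The set [X] consists of [U] and the small atoms.  If one of the two sets in
    [exceptional] had [m] elements, it would contain a stable [d]-set [J], and
    [w] (as well as [w']) would belong to an atom defined by [J]; this atom is
    large because [w] is outside [X], and large atoms give a double star. *)
Lemma exceptional_ex U n : #|U| <= n -> exists2 X, exceptional U X & #|X| <= exc_bound n.
Proof.
move=> cU; pose q := m * m + m.
pose sm l i J := if #|atom U l i J| < q then atom U l i J else set0.
pose dsub := [set J : {set G} | J \subset U & #|J| == d].
pose X := U :|: \bigcup_(l in U) \bigcup_(i in U) \bigcup_(J in dsub) sm l i J.
have big w l i J : w \notin X -> l \in U -> i \in U -> J \in dsub ->
    w \in atom U l i J -> q <= #|atom U l i J|.
  move=> wX lU iU JU wa; rewrite leqNgt; apply: contra wX => lt_q.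
  rewrite inE; apply/orP; right.
  apply/bigcupP; exists l => //; apply/bigcupP; exists i => //.
  by apply/bigcupP; exists J => //; rewrite /sm lt_q.
have notU w : w \notin X -> w \notin U by apply: contra => wU; rewrite inE wU.
exists X; first split.
- exact: subsetUl.
- move=> w l i wX lU iU il lw iw; rewrite ltnNge; apply/negP.
  case/ramsey=> J [sJ cJ stJ].
  have inJ z : z \in J -> [/\ z \notin nbrs w, z \notin nbrs l, z \in U & z \in nbrs i].
    by move/(subsetP sJ); rewrite !inE => /and3P[-> -> /andP[-> ->]].
  have JU : J \in dsub.
    by rewrite inE cJ eqxx andbT; apply/subsetP=> z /inJ[].
  have wa : w \in atom U l i J by apply/atomP; split; rewrite ?notU // => z /inJ[].
  have := big _ _ _ _ wX lU iU JU wa; rewrite leqNgt => /negP[].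
  have sJp : J \subset priv i l.
    apply/subsetP=> z /inJ[zw zl zU zi]; rewrite in_priv zl zi !andbT.
    by apply: contraNneq zw => ->.
  have li : l \in nbrs i by rewrite nbrs_sym.
  have := few_private_stable li sJp cJ stJ (atom_priv _ _ iU) (atom_anti _ _ _ _).
  by move/leq_trans; apply; apply: leq_addl.
- move=> w w' l i wX w'X lU iU il lw iw lw' iw'; rewrite ltnNge; apply/negP.
  case/ramsey=> J [sJ cJ stJ].
  have inJ z : z \in J ->
      [/\ z \notin nbrs w, z \notin nbrs w', z \in U & z \in nbrs l /\ z \in nbrs i].
    by move/(subsetP sJ); rewrite !inE => /and3P[-> -> /andP[/andP[-> ->] ->]].
  have JU : J \in dsub.
    by rewrite inE cJ eqxx andbT; apply/subsetP=> z /inJ[].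
  have wa : w \in atom U l i J by apply/atomP; split; rewrite ?notU // => z /inJ[].
  have w'a : w' \in atom U i l J.
    by apply/atomP; split; rewrite ?notU // => z /inJ[].
  have bigP := big _ _ _ _ wX lU iU JU wa.
  have bigP' := big _ _ _ _ w'X iU lU JU w'a.
  (* The edge between [p] and [l], with the leaves [J] at [l]. *)
  have few p : p \in atom U l i J -> #|atom U i l J :&: nbrs p| <= m.
    case/atomP=> pU lp ip Jp; apply: ltnW.
    have pl : p \in nbrs l by rewrite nbrs_sym.
    have sJp : J \subset priv l p.
      apply/subsetP=> z zJ; have [_ _ zU [zl _]] := inJ z zJ.
      rewrite in_priv zl Jp // !andbT; by apply: contraNneq pU => <-.
    apply: (few_private_stable pl sJp cJ stJ).
      apply/subsetP=> z /setIP[/atomP[zU iz lz _] zp].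
      rewrite in_priv zp andbT nbrs_sym lz andbT.
      by apply: contraNneq zU => ->.
    exact: anticompleteS (subsetIl _ _) (atom_anti _ _ _ _).
  have [|P1 sP1 cP1] := @subset_of_card _ (atom U l i J) m.
    exact: leq_trans (leq_addl _ _) bigP.
  pose D := atom U i l J :\: \bigcup_(p in P1) (atom U i l J :&: nbrs p).
  have cD : m <= #|D|.
    have := cardsID (\bigcup_(p in P1) (atom U i l J :&: nbrs p)) (atom U i l J).
    have /card_bigcup_le : forall p, p \in P1 -> #|atom U i l J :&: nbrs p| <= m.
      by move=> p /(subsetP sP1)/few.
    rewrite cP1 -/D.
    have := subset_leq_card (subsetIr (atom U i l J)
      (\bigcup_(p in P1) (atom U i l J :&: nbrs p))).
    move: bigP'; rewrite /q -/D; move: #|_ :&: _| #|\bigcup_(_ in _) _| #|D| #|atom _ _ _ _|.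
    by clear; lia.
  (* Now [P1] and [D] are anticomplete sets of leaves at [l] and [i]. *)
  have P1p := subset_trans sP1 (atom_priv _ _ iU).
  have Dp : D \subset priv i l := subset_trans (subsetDl _ _) (atom_priv _ _ lU).
  have := few_private il P1p Dp; rewrite cP1 leqnn ltnNge cD => /(_ _ isT)/negP; apply=> //.
  apply/anticompleteP=> p z pP1 /setDP[za /bigcupP zn].
  by rewrite nbrs_sym; apply/negP=> zp; case: zn; exists p => //; rewrite inE za.
rewrite /exc_bound (leq_trans (leq_card_setU _ _)) // leq_add //.
apply: (leq_trans (card_bigcup_le (b := n * (n ^ d * q)) _)); last by rewrite leq_mul.
move=> l _; apply: (leq_trans (card_bigcup_le (b := n ^ d * q) _)); last by rewrite leq_mul.
move=> i _; apply: (leq_trans (card_bigcup_le (b := q) _)).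
  by move=> J _; rewrite /sm; case: ifP => [/ltnW//|_]; rewrite cards0.
by rewrite leq_mul // cards_draws (bin_le_exp _ cU).
Qed.

End Exceptional.

(** * Jointless sets and templates *)

(** Each of the following sizes exceeds the previous ones by factors polynomial in
    [k] and [m].  A set of size [m] contains a stable [d]-set; the two sides of a
    joint have size at least [z0]; a vertex of one part misses at most [t]
    vertices of any other; a vertex of the core misses at most [tau] vertices of
    each part; an old part loses at most [delta] vertices when a part is added;
    and parts have size at most [D0]. *)
Section Templates.
Variables (G : sgraph) (k m z0 t tau delta D0 : nat).
Implicit Types (x y u v w : G) (A B P Q R S U W X Z D : {set G}).
Hypothesis clique_le : forall Q, is_clique Q -> #|Q| <= k.

Lemma sum_nonnbrs A B : \sum_(a in A) #|B :\: nbrs a| = \sum_(b in B) #|A :\: nbrs b|.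
Proof.
have cE (X : {set G}) x : #|X :\: nbrs x| = \sum_(y in X) (y \notin nbrs x : nat).
  rewrite -sum1_card big_mkcond [RHS]big_mkcond; apply: eq_bigr => y _.
  by rewrite in_setD; case: (y \in X); case: (y \in nbrs x).
rewrite (eq_bigr _ (fun a _ => cE B a)) exchange_big /=.
apply: eq_bigr => b _; rewrite cE; apply: eq_bigr => a _.
by rewrite nbrs_sym.
Qed.

(** Double counting of nonadjacent pairs: after the deletion of few vertices of
    [P], nearness of [Q] to [P] holds in the other direction as well. *)
Lemma card_bad Q P b c : near b Q P -> #|Q| * b <= c * c ->
  #|[set p in P | c < #|Q :\: nbrs p|]| <= c.
Proof.
move=> /nearP nQP le_c; set B := [set p in P | _].
have h1 : \sum_(p in B) c.+1 <= \sum_(p in B) #|Q :\: nbrs p|.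
  by apply: leq_sum => p; rewrite inE => /andP[].
have h2 : \sum_(q in Q) #|B :\: nbrs q| <= \sum_(q in Q) b.
  apply: leq_sum => q /nQP; apply: leq_trans.
  by rewrite subset_leq_card // setSD //; apply/subsetP=> p; rewrite inE => /andP[].
move: h1 h2; rewrite sum_nonnbrs !sum_nat_const; nia.
Qed.

(** An approximate form of having a connected complement: up to [rho] vertices, [P]
    is not the union of sets [R] and [Z] of size at least [z0] with [R] almost
    complete to [Z]. *)
Definition jointless rho P := [forall R : {set G}, forall Z : {set G},
  [&& R \subset P, Z \subset P, near m R Z & #|P :\: (R :|: Z)| <= rho] ==>
  ((#|R| < z0) || (#|Z| < z0))].

Lemma jointlessP rho P R Z : jointless rho P -> R \subset P -> Z \subset P ->
  near m R Z -> #|P :\: (R :|: Z)| <= rho -> (#|R| < z0) || (#|Z| < z0).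
Proof. by move=> /forallP/(_ R)/forallP/(_ Z)/implyP h ? ? ? ?; apply: h; apply/and4P. Qed.

Lemma jointlessS rho c P Q : jointless (rho + c) P -> Q \subset P ->
  #|P :\: Q| <= c -> jointless rho Q.
Proof.
move=> jP sQP cPQ; apply/forallP=> R; apply/forallP=> Z; apply/implyP=> /and4P[sR sZ RZ cRZ].
apply: (jointlessP jP) => //; [exact: subset_trans sQP|exact: subset_trans sQP|].
apply: (@leq_trans #|(Q :\: (R :|: Z)) :|: (P :\: Q)|).
  apply/subset_leq_card/subsetP=> x /setDP[xP xRZ]; rewrite inE !in_setD xRZ xP.
  by case: (x \in Q).
by rewrite (leq_trans (leq_card_setU _ _)) // leq_add.
Qed.

Hypothesis z0_gt : m * k.+1 < z0.

(** Starting from [P], replace a set that is not jointless by the two sets [Z] and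
    [R] into which it splits.  In the resulting sequence each set is near to all
    earlier ones, so its length stays at most [k], and some member always has
    about a [k]-th of the vertices of [P]. *)
Lemma jointless_subset n rho P : z0 <= n -> k * (n + rho) < #|P| -> n <= #|P| ->
  exists Q : {set G}, [/\ Q \subset P, n <= #|Q| & jointless rho Q].
Proof.
move=> le_z0 bigP bigP'.
suff chain j (s : seq {set G}) : size s + j = k.+1 ->
    pairwise (fun A B => near m B A) s ->
    all (fun A : {set G} => (z0 <= #|A|) && (A \subset P)) s ->
    #|P| <= \sum_(A <- s) #|A| + size s * rho ->
    exists Q : {set G}, [/\ Q \subset P, n <= #|Q| & jointless rho Q].
  by apply: (@chain k [:: P]) => //=; rewrite ?big_seq1 ?subxx ?(leq_trans le_z0) // leq_addr.
elim: j s => [|j IHj] s ss ps sP cP.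
  have : size s <= k; last by lia.
  apply: (clique_transversal clique_le ps); apply/allP=> A /(allP sP)/andP[zA _].
  by apply: leq_trans zA; rewrite -[size s]addn0 ss.
have [/hasP[A As nA]|/hasPn small] := boolP (has (fun A : {set G} => n <= #|A|) s); last first.
  have le_s : \sum_(A <- s) #|A| <= \sum_(A <- s) n.
    by rewrite !big_seq; apply: leq_sum => A /small; rewrite -ltnNge => /ltnW.
  move: le_s; rewrite big_const_seq count_predT iter_addn_0 => le_s.
  have le_sk : size s <= k by lia.
  have : size s * (n + rho) <= k * (n + rho) by rewrite leq_mul2r le_sk orbT.
  by move: cP le_s bigP; lia.
have [jA|] := boolP (jointless rho A).
  by exists A; split=> //; have /andP[] := allP sP A As.
case/forallPn=> R /forallPn[Z]; rewrite negb_imply negb_or -!leqNgt.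
case/andP=> /and4P[sR sZ RZ cRZ] /andP[bR bZ].
case: (splitPr As) ss ps sP cP => s1 s2 ss.
rewrite !pairwise_cat !allrel_consr /= all_cat /= !big_cat !big_cons /=.
case/and3P=> /andP[s1A s12] ps1 /andP[As2 ps2] /and3P[s1P /andP[_ sA] s2P] cP.
have s1S B : B \subset A -> all (near m B) s1.
  by move=> sB; apply: sub_all s1A => C; apply: nearS.
have s2S B : B \subset A -> all (fun C => near m C B) s2.
  by move=> sB; apply: sub_all As2 => C; apply: nearS.
apply: (IHj (s1 ++ Z :: R :: s2)).
- by move: ss; clear; rewrite !size_cat /= !addnS.
- rewrite pairwise_cat !allrel_consr /= RZ ps1 ps2 s12 !s2S //= !andbT.
  by rewrite (s1S Z) // (s1S R).
- by rewrite all_cat /= s1P s2P bR bZ !(subset_trans _ sA).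
have : #|A| <= #|R| + #|Z| + rho.
  rewrite -(cardsID (R :|: Z) A) leq_add //.
  rewrite (leq_trans (subset_leq_card (subsetIr _ _))) //.
  by rewrite leq_card_setU.
move: cP; clear; rewrite !size_cat /= big_cat !big_cons /= !addnS !mulSn.
by move: #|A| #|R| #|Z| (\sum_(_ <- _) _) (\sum_(_ <- _) _) (_ * rho) => *; lia.
Qed.

(** The index [j] counts the parts that can still be added.  Each addition deletes
    at most [delta] vertices from every old part, so the lower bound on part
    sizes and the tolerance for joints both drop by [delta]. *)
Definition part_size j := (j + 4 * k.+1) * delta.
Definition slack j := j.+1 * delta.

Definition template j (I : finType) (P : I -> {set G}) :=
  [/\ forall i, part_size j <= #|P i|, forall i, #|P i| <= D0,
      forall i, jointless (slack j) (P i) &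
      forall i i', i != i' -> near t (P i) (P i')].

Lemma delta_le_part j : delta <= part_size j.
Proof. by rewrite /part_size leq_pmull // mulnS addnCA. Qed.

Hypothesis z0_le : z0 <= t.
Hypothesis delta_eq : tau + t = delta.
Hypothesis D0_eq : 7 * k.+1 ^ 2 * delta = D0.
Hypothesis t_big : D0 * z0 <= t * t.

Lemma template_le j (I : finType) (P : I -> {set G}) :
  template j P -> #|I| <= k.+1 -> #|I| <= k.
Proof.
case=> bigP _ _ nP le_I; have := @clique_transversal _ _ clique_le t [seq P i | i <- enum I].
rewrite size_map -cardE; apply.
  rewrite pairwise_map; have := enum_uniq I; rewrite uniq_pairwise.
  by apply: sub_pairwise => i i' /= ii'; apply: nP; rewrite eq_sym.
apply/allP=> _ /mapP[i _ ->]; apply: leq_trans (bigP i); rewrite /part_size -delta_eq.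
have tpos : 0 < t by move: z0_gt z0_le; clear; lia.
apply: (@leq_ltn_trans (k.+1 * t)); first by rewrite mulnC leq_mul2r le_I orbT.
apply: (@leq_trans (4 * k.+1 * t)); first by rewrite ltn_pmul2r // ltn_Pmull.
by rewrite leq_mul // ?leq_addl.
Qed.

(** The new part is a jointless subset [Q] of [D].  Its vertices miss few vertices
    of the old parts by hypothesis; [card_bad] gives the converse. *)
Lemma template_add j (I : finType) (P P' : I -> {set G}) D :
  j <= k -> template j.+1 P -> D0 <= #|D| ->
  (forall i, P' i \subset P i) -> (forall i, #|P i :\: P' i| <= tau) ->
  (forall i, near z0 D (P' i)) ->
  exists P'' : option I -> {set G}, template j P''.
Proof.
move=> le_jk [bigP leP jP nP] /subset_of_card[D1 sD1 cD1] sP' cP' nD.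
have [||| Q [sQ bigQ jQ]] := @jointless_subset (part_size j) (slack j) D1.
- apply: (leq_trans z0_le); apply: leq_trans (delta_le_part _).
  by rewrite -delta_eq leq_addl.
- have dpos : 0 < delta by rewrite -delta_eq; move: z0_gt z0_le; clear; lia.
  rewrite cD1 /part_size /slack -D0_eq -mulnDl mulnA ltn_pmul2r // expnS expn1.
  by move: le_jk; clear; nia.
- rewrite cD1 /part_size -D0_eq leq_mul2r expnS expn1; apply/orP; right.
  by move: le_jk; clear; nia.
have cQ : #|Q| <= D0 by rewrite -cD1 subset_leq_card.
have nQ i : near z0 Q (P' i) by apply: nearS (nD i) => //; apply: subset_trans sD1.
have le_t : #|Q| * z0 <= t * t by apply: leq_trans t_big; rewrite leq_mul2r cQ orbT.
pose bad i := [set p in P' i | t < #|Q :\: nbrs p|].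
have cbad i : #|bad i| <= t := card_bad (nQ i) le_t.
pose R i := P' i :\: bad i.
have sR i : R i \subset P' i by exact: subsetDl.
have sRP i : R i \subset P i := subset_trans (sR i) (sP' i).
have cR i : #|P i :\: R i| <= delta.
  rewrite -delta_eq; apply: (@leq_trans #|(P i :\: P' i) :|: bad i|).
    apply/subset_leq_card/subsetP=> x; rewrite !in_setD in_setU !in_setD.
    by case: (x \in bad i); rewrite ?orbT // => /andP[-> ->].
  by rewrite (leq_trans (leq_card_setU _ _)) // leq_add.
exists (fun o => if o is Some i then R i else Q); split.
- case=> [i|//]; have := bigP i; rewrite -(cardsID (R i) (P i)).
  have := subset_leq_card (subsetIr (P i) (R i)); have := cR i.
  rewrite /part_size; nia.
- by case=> [i|//]; apply: leq_trans (leP i); apply: subset_leq_card.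
- case=> [i|//]; apply: jointlessS (sRP i) (cR i).
  by have := jP i; rewrite /slack [in X in X -> _]mulSn addnC.
case=> [i|] [i'|] //.
- rewrite (inj_eq (@Some_inj _)) => /nP; exact: nearS.
- by move=> _; apply/nearP=> p /setDP[pP']; rewrite inE pP' /= -leqNgt.
- by move=> _; apply: near_le z0_le _; apply: nearS (nQ i').
Qed.

End Templates.

(** * How an unexceptional vertex sees a template *)

Section Traces.
Variables (G : sgraph) (k d m z0 t mu tau delta D0 : nat).
Implicit Types (x y u v w : G) (A B F Q R S W Z D : {set G}).
Hypothesis clique_le : forall Q, is_clique Q -> #|Q| <= k.
Hypothesis ramsey : forall A, m <= #|A| ->
  exists I : {set G}, [/\ I \subset A, #|I| = d & stable I].
Hypothesis dsf : double_star_free d G.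
Hypothesis z0_gt : m * k.+1 < z0.
Hypothesis z0_le : z0 <= t.
Hypothesis mu_eq : z0 + t = mu.
Hypothesis tau_eq : (m + 2) * mu + m = tau.
Hypothesis delta_eq : tau + t = delta.

Variables (j : nat) (I : finType) (P : I -> {set G}) (X : {set G}).
Hypothesis tP : template k m z0 t delta D0 j P.
Hypothesis I_gt1 : 1 < #|I|.
Definition union_parts := \bigcup_i P i.
Local Notation U := union_parts.
Hypothesis excX : exceptional m U X.

Lemma sub_union i : P i \subset U. Proof. exact: bigcup_sup. Qed.

Lemma in_union i x : x \in P i -> x \in U.
Proof. exact/subsetP/sub_union. Qed.

Lemma union_notin w x : w \notin X -> x \in U -> w != x.
Proof.
case: excX => /subsetP sUX _ _ wX xU.
by apply: contraNneq wX => ->; apply: sUX.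
Qed.

Lemma part_big i : 4 * k.+1 * delta <= #|P i|.
Proof.
by case: tP => /(_ i) bigP _ _ _; apply: leq_trans bigP; rewrite leq_mul2r leq_addl orbT.
Qed.

Lemma part_big4 i : 4 * delta <= #|P i|.
Proof. by apply: leq_trans (part_big i); rewrite leq_mul2r leq_pmulr ?orbT. Qed.

Lemma t_le_mu : t <= mu. Proof. by rewrite -mu_eq leq_addl. Qed.
Lemma mu_gt0 : 0 < mu. Proof. by rewrite -mu_eq; move: z0_gt; clear; lia. Qed.
Lemma mu_le_tau : mu <= tau.
Proof. by rewrite -tau_eq (leq_trans _ (leq_addr _ _)) // leq_pmull // addn2. Qed.

Lemma near_parts i i' p : i != i' -> p \in P i -> #|P i' :\: nbrs p| <= t.
Proof. by case: tP => _ _ _ /(_ i i') nP /nP/nearP; apply. Qed.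

(** The parts to which [w] is not almost complete; [missed_off] and [missed_on]
    improve the threshold [tau] to [mu] in both directions. *)
Definition missed w := [set i | tau <= #|P i :\: nbrs w|].

Lemma in_missed w i : (i \in missed w) = (tau <= #|P i :\: nbrs w|).
Proof. by rewrite inE. Qed.

(** Let [R] and [Z] be the neighbours and nonneighbours of [w] in the part, among
    the neighbours of [a].  As [w] is unexceptional, [R] is near to [Z], so one
    of them is small because the part is jointless. *)
Lemma part_pure w i i' a : w \notin X -> a \in P i' -> a \notin nbrs w -> i != i' ->
  #|P i :&: nbrs w| < mu \/ #|P i :\: nbrs w| < mu.
Proof.
move=> wX aP aw ii'; have [_ exc1 _] := excX.
pose R := P i :&: nbrs w :&: nbrs a; pose Z := (P i :&: nbrs a) :\: nbrs w.
have sR : R \subset P i by rewrite /R -setIA subsetIl.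
have sZ : Z \subset P i by rewrite /Z (subset_trans (subsetDl _ _)) ?subsetIl.
have Ba : #|P i :\: nbrs a| <= t by apply: near_parts aP; rewrite eq_sym.
have nRZ : near m R Z.
  apply/nearP=> l /setIP[/setIP[lP lw] la]; apply: ltnW.
  have al : a \in nbrs l by rewrite nbrs_sym.
  apply: leq_ltn_trans (exc1 w l a wX (in_union lP) (in_union aP) al lw aw).
  apply/subset_leq_card/subsetP=> z; rewrite !inE => /and4P[-> -> zP ->].
  by rewrite (in_union zP).
have cRZ : #|P i :\: (R :|: Z)| <= slack delta j.
  have : #|P i :\: nbrs a| <= slack delta j.
    by apply: leq_trans Ba _; rewrite /slack mulSn -delta_eq -addnA addnCA leq_addr.
  apply: card_subset_le.
  apply/subsetP=> x; rewrite !inE => /andP[+ xP]; rewrite xP andbT.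
  by case: (x \in nbrs a); case: (x \in nbrs w); rewrite ?xP.
have [_ _ /(_ i) jP _] := tP.
have /orP[cR|cZ] := jointlessP jP sR sZ nRZ cRZ; [left|right].
  have : #|(P i :&: nbrs w) :\: nbrs a| <= t by apply: card_subset_le Ba; rewrite setSD ?subsetIl.
  by move/card_inter; rewrite -/R; move: cR mu_eq; clear; lia.
have : #|(P i :\: nbrs w) :\: nbrs a| <= t by apply: card_subset_le Ba; rewrite setSD ?subsetDl.
move/card_inter; have -> : (P i :\: nbrs w) :&: nbrs a = Z by rewrite /Z setIDAC.
by move: cZ mu_eq; clear; lia.
Qed.

Lemma missed_witness w i : i \in missed w -> exists2 a, a \in P i & a \notin nbrs w.
Proof.
rewrite in_missed => big; have : 0 < #|P i :\: nbrs w|.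
  by apply: leq_trans big; apply: leq_trans mu_gt0 mu_le_tau.
by case/card_gt0P=> a /setDP[aP aw]; exists a.
Qed.

Lemma missed_off w i i' : w \notin X -> i \in missed w -> i' \notin missed w ->
  #|P i' :\: nbrs w| < mu.
Proof.
move=> wX iT i'T; have [a aP aw] := missed_witness iT.
have [|small|//] := part_pure wX aP aw (i := i'); first by apply: contraNneq i'T => ->.
move: i'T; rewrite in_missed -ltnNge => lt_tau.
have := part_big4 i'; rewrite -(cardsID (nbrs w)).
by move: lt_tau small mu_le_tau delta_eq; clear; lia.
Qed.

Lemma missed_on w i i' : w \notin X -> i \in missed w -> i' \in missed w -> i != i' ->
  #|P i :&: nbrs w| < mu.
Proof.
move=> wX iT i'T ii'; have [a aP aw] := missed_witness i'T.
have [//|] := part_pure wX aP aw ii'.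
by move: iT mu_le_tau; rewrite in_missed; clear; lia.
Qed.

(** If the parts missed by [w] and by [w'] crossed, then representatives of the
    parts [i'] and [i], together with many common nonneighbours in the part [l],
    would contradict the second property of exceptional sets. *)
Lemma missed_laminar w w' i i' l : w \notin X -> w' \notin X ->
  i \in missed w -> i \notin missed w' -> i' \in missed w' -> i' \notin missed w ->
  l \in missed w -> l \in missed w' -> False.
Proof.
move=> wX w'X iT iT' i'T' i'T lT lT'; have [_ _ exc2] := excX.
have li : l != i by apply: contraNneq iT' => <-.
have li' : l != i' by apply: contraNneq i'T => <-.
have ii' : i != i' by apply: contraNneq i'T => <-.
have mule : t <= mu /\ 2 * mu + m <= tau.
  by split; [exact: t_le_mu | rewrite -tau_eq mulnDl -addnA leq_addl].
have sz := part_big4.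
have il : i != l by rewrite eq_sym.
have i'l : i' != l by rewrite eq_sym.
have wi := missed_on wX iT lT il; have wl := missed_on wX lT iT li.
have w'i' := missed_on w'X i'T' lT' i'l; have w'l := missed_on w'X lT' i'T' li'.
have wi' := missed_off wX iT i'T; have w'i := missed_off w'X i'T' iT'.
have [x xP'] : exists x, x \in (P i' :&: nbrs w) :\: nbrs w'.
  apply/card_gt0P.
  have h1 := card_inter (ltnW wi').
  have h2 : #|(P i' :&: nbrs w) :&: nbrs w'| <= mu.
    by apply: card_subset_le (ltnW w'i'); rewrite setSI ?subsetIl.
  move/card_minus: h2; move: h1 (sz i') delta_eq mule mu_gt0; clear; lia.
move: xP'; rewrite !inE => /and3P[xw' xP xw].
have [y yP'] : exists y, y \in ((P i :&: nbrs w') :\: nbrs w) :&: nbrs x.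
  apply/card_gt0P.
  have h1 := card_inter (ltnW w'i).
  have h2 : #|(P i :&: nbrs w') :&: nbrs w| <= mu.
    by apply: card_subset_le (ltnW wi); rewrite setSI ?subsetIl.
  have h3 : #|((P i :&: nbrs w') :\: nbrs w) :\: nbrs x| <= t.
    have i'i : i' != i by rewrite eq_sym.
    apply: card_subset_le (near_parts i'i xP).
    by rewrite setSD // (subset_trans (subsetDl _ _)) ?subsetIl.
  move/card_inter: h3; move/card_minus: h2.
  move: h1 (sz i) delta_eq mule mu_gt0; clear; lia.
move: yP'; rewrite !inE => /andP[/and3P[yw yP yw'] yx].
have := exc2 w w' x y wX w'X (in_union xP) (in_union yP) yx xw yw xw' yw'.
rewrite ltnNge => /negP; apply.
apply: (@leq_trans #|(P l :&: nbrs x :&: nbrs y) :\: nbrs w :\: nbrs w'|); last first.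
  by rewrite subset_leq_card // !setSD // !setSI ?sub_union.
have h1 : #|P l :\: nbrs x| <= t by exact: near_parts i'l xP.
have h2 : #|P l :&: nbrs x :\: nbrs y| <= t.
  by apply: card_subset_le (near_parts il yP); rewrite setSD ?subsetIl.
have h3 : #|P l :&: nbrs x :&: nbrs y :&: nbrs w| <= mu.
  by apply: card_subset_le (ltnW wl); rewrite setSI // -setIA subsetIl.
have h4 : #|((P l :&: nbrs x :&: nbrs y) :\: nbrs w) :&: nbrs w'| <= mu.
  apply: card_subset_le (ltnW w'l); rewrite setSI //.
  by rewrite (subset_trans (subsetDl _ _)) // -setIA subsetIl.
move/card_inter: h1; move/card_inter: h2; move/card_minus: h3; move/card_minus: h4.
move: (sz l) delta_eq mule mu_gt0; clear; lia.
Qed.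

Definition far := [set w | (w \notin X) && (missed w == setT)].

Lemma farP w : reflect (w \notin X /\ missed w = setT) (w \in far).
Proof. by rewrite inE; apply: (iffP andP) => -[? /eqP]. Qed.

Lemma other_part (i : I) : exists i', i' != i.
Proof.
have : 0 < #|[set~ i]| by rewrite cardsC1; case: #|I| I_gt1 => [|[]].
by case/card_gt0P=> i'; rewrite !inE; exists i'.
Qed.

Lemma far_part f i : f \in far -> #|P i :&: nbrs f| <= mu.
Proof.
case/farP=> fX Tf; have [i' i'i] := other_part i; apply: ltnW.
by apply: (missed_on fX (i' := i')); rewrite ?Tf ?inE // eq_sym.
Qed.

Lemma far_notin_union f x : f \in far -> x \in U -> f != x.
Proof. by case/farP=> fX _; apply: union_notin. Qed.

(** Otherwise [v] and a neighbour of [v] in the part [i] are the centres of a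
    double star, with leaves among the far neighbours of [v] and among the
    vertices of the part [i'] that [v] misses. *)
Lemma few_far v i i' : i != i' -> #|P i :\: nbrs v| <= mu ->
  tau <= #|P i' :\: nbrs v| -> #|nbrs v :&: far| < m.
Proof.
move=> ii' nvi vi'; rewrite ltnNge; apply/negP.
case/subset_of_card=> F sF cF.
have Ff f : f \in F -> f \in far /\ f \in nbrs v.
  by move/(subsetP sF)/setIP=> [].
have [l lP'] : exists l, l \in (P i :&: nbrs v) :\: nbrs_of F.
  apply/card_gt0P; have h1 := card_inter nvi.
  have : #|P i :&: nbrs v :&: nbrs_of F| <= #|F| * mu.
    apply: card_meet_nbrs_of => f /Ff[ff _]; apply: card_subset_le (far_part i ff).
    by rewrite setSI ?subsetIl.
  move/card_minus; rewrite cF.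
  move: h1 (part_big4 i) delta_eq tau_eq mu_gt0; clear; nia.
move: lP'; rewrite !inE => /and3P[lF lP lv].
(* The edge between [v] and [l], with leaves [F] and [B]. *)
pose B := ((P i' :\: nbrs v) :&: nbrs l) :\: nbrs_of F :\ v.
have h1 : #|P i' :\: nbrs v :\: nbrs l| <= t.
  by apply: card_subset_le (near_parts ii' lP); rewrite setSD ?subsetDl.
have h2 : #|(P i' :\: nbrs v) :&: nbrs l :&: nbrs_of F| <= m * mu.
  rewrite -cF; apply: card_meet_nbrs_of => f /Ff[ff _]; apply: card_subset_le (far_part i' ff).
  by rewrite setSI // (subset_trans (subsetIl _ _)) ?subsetDl.
have bigB : m <= #|B|.
  have := leq_b1 (v \in ((P i' :\: nbrs v) :&: nbrs l) :\: nbrs_of F).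
  have := cardsD1 v (((P i' :\: nbrs v) :&: nbrs l) :\: nbrs_of F); rewrite -/B.
  move/card_inter: h1; move/card_minus: h2.
  move: (vi') tau_eq t_le_mu mu_gt0; clear; nia.
have : #|B| < m; last by rewrite ltnNge bigB.
apply: (few_private ramsey dsf lv (A := F)); rewrite ?cF //.
- apply/subsetP=> f fF; have [ff fv] := Ff f fF; rewrite in_priv fv andbT.
  by rewrite (far_notin_union ff (in_union lP)) nbrs_sym (notin_nbrs_of lF).
- apply/subsetP=> b; rewrite in_priv !inE => /and4P[bv _ /andP[bnv _] bl].
  by rewrite bv bnv bl.
apply/anticompleteP=> f b fF; rewrite !inE => /and3P[_ bF _].
by rewrite nbrs_sym (notin_nbrs_of bF).
Qed.

(** The far neighbours of [x] outside [nbrs y] are few, because they are private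
    neighbours of [x], while [y] has many private neighbours in a part to which
    it is almost complete.  Those in [nbrs y] are few by [few_far]. *)
Lemma far_degree x y i : x \in far -> y \in nbrs x -> y \notin X -> missed y != setT ->
  i \in missed y -> #|nbrs x :&: far| < m + m.
Proof.
move=> xf yx yX TyT iT.
have [i' i'T] : exists i', i' \notin missed y.
  apply/existsP; rewrite -negb_forall; apply: contra TyT => /forallP h.
  by apply/eqP/setP=> z; rewrite h inE.
have nyi := missed_off yX iT i'T.
have yfar : y \notin far by apply/farP=> -[_ /eqP]; rewrite (negPf TyT).
have ii' : i' != i by apply: contraNneq i'T => ->.
have few_y : #|nbrs y :&: far| < m.
  by apply: (few_far ii' (ltnW nyi)); rewrite -in_missed.
(* The edge between [x] and [y], with leaves in [far] and in the part [i']. *)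
suff few_x : #|nbrs x :&: far :\: nbrs y| < m.
  have : #|nbrs x :&: far :&: nbrs y| <= #|nbrs y :&: far|.
    by apply/subset_leq_card/subsetP=> z; rewrite !inE => /andP[/andP[_ ->] ->].
  by rewrite -(cardsID (nbrs y) (nbrs x :&: far)); move: few_x few_y; clear; lia.
rewrite ltnNge; apply/negP; case/subset_of_card=> F sF cF.
have Ff f : f \in F -> [/\ f \in far, f \in nbrs x & f \notin nbrs y].
  by move/(subsetP sF); rewrite !(in_setI, in_setD) => /andP[-> /andP[-> ->]].
pose B := (P i' :&: nbrs y) :\: nbrs x :\: nbrs_of F.
have h1 := card_inter (ltnW nyi).
have h2 : #|P i' :&: nbrs y :&: nbrs x| <= mu.
  by apply: card_subset_le (far_part i' xf); rewrite setSI ?subsetIl.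
have h3 : #|((P i' :&: nbrs y) :\: nbrs x) :&: nbrs_of F| <= m * mu.
  rewrite -cF; apply: card_meet_nbrs_of => f /Ff[ff _ _]; apply: card_subset_le (far_part i' ff).
  by rewrite setSI // (subset_trans (subsetDl _ _)) ?subsetIl.
have bigB : m <= #|B|.
  move/card_minus: h2; move/card_minus: h3; rewrite -/B.
  move: h1 (part_big4 i') delta_eq tau_eq t_le_mu mu_gt0; clear; nia.
have : #|B| < m; last by rewrite ltnNge bigB.
apply: (few_private ramsey dsf yx (A := F)); rewrite ?cF //.
- apply/subsetP=> f fF; have [ff fx fy] := Ff f fF; rewrite in_priv fx fy !andbT.
  by apply: contraNneq yfar => <-.
- apply/subsetP=> b; rewrite in_priv !in_setD in_setI => /and3P[_ bx /andP[bP by_]].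
  by rewrite by_ bx eq_sym (far_notin_union xf (in_union bP)).
apply/anticompleteP=> f b fF; rewrite in_setD => /andP[bF _].
by rewrite nbrs_sym (notin_nbrs_of bF).
Qed.

Definition mid := [set w | [&& w \notin X, missed w != set0 & missed w != setT]].

Lemma midP w : reflect [/\ w \notin X, missed w != set0 & missed w != setT] (w \in mid).
Proof. by rewrite inE; apply: and3P. Qed.

(** Used to show that middle vertices exist: such a vertex [u] has large degree,
    few of its neighbours are far, and few vertices are exceptional or belong to
    the core. *)
Lemma few_far_start : exists2 u, u \in U & #|nbrs u :&: far| < m.
Proof.
have [i0 _] : exists i0 : I, true.
  by have /card_gt0P[i0 _] : 0 < #|I| := ltnW I_gt1; exists i0.
have tpos : 0 < t by move: z0_gt z0_le; clear; lia.
have [|v vP bigv] := many_nonnbrs clique_le (A := P i0) (b := tau).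
  apply: leq_trans (part_big i0); rewrite -delta_eq -mulnA.
  apply: leq_ltn_trans (leq_pmull _ (isT : 0 < 4)) _.
  by rewrite !ltn_pmul2l // -[X in X < _]addn0 ltn_add2l.
exists v; first exact: in_union vP.
have [i ii0] := other_part i0.
have i0i : i0 != i by rewrite eq_sym.
apply: (few_far ii0) (ltnW bigv).
exact: leq_trans (near_parts i0i vP) t_le_mu.
Qed.

(** A largest set of missed parts contains or avoids all the others, by
    laminarity. *)
Lemma laminar_top : mid != set0 -> exists T0 : {set I},
  [/\ T0 != set0, T0 != setT &
      {in mid, forall w, missed w \subset T0 \/ [disjoint missed w & T0]}].
Proof.
case/set0Pn=> w0 w0m; case: (arg_maxnP (fun w => #|missed w|) w0m) => w wm maxw.
have [wX wT0 wT] := midP _ wm; exists (missed w); split=> // w' w'm.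
have [w'X _ _] := midP _ w'm.
have [?|/subsetPn[i' i'T' i'T]] := boolP (missed w' \subset missed w); [by left|right].
rewrite -setI_eq0; apply: contraT => /set0Pn[l /setIP[lT' lT]].
have [/subsetP sT|/subsetPn[i iT iT']] := boolP (missed w \subset missed w').
  have : missed w \proper missed w' by apply/properP; split; [apply/subsetP|exists i'].
  by move/proper_card; rewrite ltnNge; have /= -> := maxw _ w'm.
by case: (missed_laminar wX w'X iT iT' i'T' i'T lT lT').
Qed.

(** This puts [y1] and [y2] in private neighbourhoods of [p] against [q] and of
    [q] against [p], which are almost complete to each other. *)
Lemma crossing_pair (T0 : {set I}) y1 y2 : y1 \in mid -> y2 \in mid ->
  missed y1 \subset T0 -> [disjoint missed y2 & T0] ->
  exists p q, [/\ p \in U, q \in U, p \in nbrs q & [/\ p \in nbrs y1, q \notin nbrs y1,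
    q \in nbrs y2 & p \notin nbrs y2]].
Proof.
case/midP=> y1X /set0Pn[i' i'T1] _ /midP[y2X /set0Pn[i iT2] _] sT dT.
have iT0 : i \notin T0 by rewrite (disjointFr dT iT2).
have i'T2 : i' \notin missed y2 by rewrite (disjointFl dT) // (subsetP sT).
have iT1 : i \notin missed y1 by apply: contra iT0; apply/subsetP.
have ii' : i != i' by apply: contraNneq iT1 => ->.
have n1 := missed_off y1X i'T1 iT1; have n2 := missed_off y2X iT2 i'T2.
have [p] : exists p, p \in (P i :\: nbrs y2) :&: nbrs y1.
  apply/card_gt0P; have : #|P i :\: nbrs y2 :\: nbrs y1| <= mu.
    by apply: card_subset_le (ltnW n1); rewrite setSD ?subsetDl.
  move/card_inter; move: iT2; rewrite in_missed -tau_eq; move: mu_gt0; clear; nia.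
rewrite !inE => /andP[/andP[py2 pP] py1].
have [q] : exists q, q \in (P i' :\: nbrs y1) :&: nbrs y2 :&: nbrs p.
  apply/card_gt0P; have h1 : #|P i' :\: nbrs y1 :\: nbrs y2| <= mu.
    by apply: card_subset_le (ltnW n2); rewrite setSD ?subsetDl.
  have h2 : #|(P i' :\: nbrs y1) :&: nbrs y2 :\: nbrs p| <= t.
    apply: card_subset_le (near_parts ii' pP).
    by rewrite setSD // (subset_trans (subsetIl _ _)) ?subsetDl.
  move/card_inter: h1; move/card_inter: h2.
  move: i'T1; rewrite in_missed -tau_eq -mu_eq; move: z0_gt; clear; nia.
rewrite !inE => /andP[/andP[/andP[qy1 qP] qy2] qp].
by exists p, q; split; rewrite ?(in_union pP) ?(in_union qP) // nbrs_sym.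
Qed.

(** A vertex of the part is adjacent to all of [Q]. *)
Lemma clique_extend Q i : is_clique Q -> {in Q, forall q, #|P i :\: nbrs q| <= mu} ->
  #|Q| < k.
Proof.
move=> cQ /common_nbrs; set A := [set a in P i | _] => le_P.
have [a] : exists a, a \in A.
  apply/card_gt0P; move: le_P (part_big i) (clique_le cQ) delta_eq mu_le_tau mu_gt0.
  clear; nia.
rewrite inE => /andP[_ Qa]; have := clique_le (clique_setU1 cQ Qa).
by rewrite cardsU1; case: (boolP (a \in Q)) => // /(subsetP Qa); rewrite (negPf (nbrs_irr a)).
Qed.

Variable n : nat.
Hypothesis cardU : #|U| <= n.

Definition pack_size := k * (n * n * m) + 1.
Definition split_bound := k.+1 * pack_size + exc_bound d m (n + k * pack_size).

(** The classes are [Y1], the vertices whose missed parts lie in the top set [T0]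
    of the laminar family, and [Y2], those whose missed parts avoid it.  If [A]
    is a union of disjoint [a]-cliques of [Y1], where [a] is the robust clique
    number, then by [crossing_pair] an unexceptional vertex of [Y2] misses few
    vertices of [A].  So a clique of [Y2] is complete to one of the [a]-cliques. *)
Lemma mid_split : mid != set0 -> exists a b (Y1 Y2 R : {set G}),
  [/\ [/\ a + b <= k, a < k & b < k], mid \subset Y1 :|: Y2 :|: R,
      Y1 \subset mid /\ Y2 \subset mid, #|R| <= split_bound &
      [/\ forall Q, Q \subset Y1 -> is_clique Q -> #|Q| <= a
        & forall Q, Q \subset Y2 -> is_clique Q -> #|Q| <= b]].
Proof.
case/laminar_top=> T0 [T00 T0T cmpT].
pose Y1 := [set w in mid | missed w \subset T0].
pose Y2 := [set w in mid | [disjoint missed w & T0]].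
have [i iT0] : exists i, i \notin T0.
  apply/existsP; rewrite -negb_forall; apply: contra T0T => /forallP h.
  by apply/eqP/setP=> z; rewrite h inE.
have [i' i'T0] := set0Pn _ T00.
have Y1k Q : Q \subset Y1 -> is_clique Q -> #|Q| < k.
  move=> sQ cQ; apply: (clique_extend (i := i) cQ) => q /(subsetP sQ).
  rewrite inE => /andP[/midP[qX /set0Pn[l lT] _] qT]; apply/ltnW/(missed_off qX lT).
  by apply: contra iT0; apply/subsetP.
have Y2k Q : Q \subset Y2 -> is_clique Q -> #|Q| < k.
  move=> sQ cQ; apply: (clique_extend (i := i') cQ) => q /(subsetP sQ).
  rewrite inE => /andP[/midP[qX /set0Pn[l lT] _] qT]; apply/ltnW/(missed_off qX lT).
  by rewrite (disjointFl qT).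
have kpos : 0 < k.
  apply: (leq_ltn_trans (leq0n #|set0 : {set G}|)); apply: (Y1k set0); rewrite ?sub0set //.
  by apply/is_cliqueP=> x; rewrite inE.
have Mpos : 0 < pack_size by rewrite /pack_size addn1.
have [a [A [R0 [le_ak sA cA pA [cR0 hR0]]]]] := clique_packing clique_le Y1 Mpos.
have cUA : #|U :|: A| <= n + k * pack_size.
  rewrite (leq_trans (leq_card_setU _ _)) // leq_add // (leq_trans cA) //.
  by rewrite leq_mul2r le_ak orbT.
have [X1 [sX1 exc1 _] cX1] := exceptional_ex ramsey dsf cUA.
(* A vertex that [y] misses in [A] is covered by some pair [p], [q] in [U]. *)
have few_A y : y \in Y2 :\: X1 -> #|A :\: nbrs y| <= n * n * m.
  rewrite inE => /andP[yX1]; rewrite inE => /andP[ym dy].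
  pose F p q := if [&& p \in nbrs q, q \in nbrs y & p \notin nbrs y]
    then A :&: nbrs p :\: nbrs q :\: nbrs y else set0.
  apply: (@card_subset_le _ _ (\bigcup_(p in U) \bigcup_(q in U) F p q)).
    apply/subsetP=> x; rewrite inE => /andP[xy xA].
    have := subsetP sA x xA; rewrite inE => /andP[xm sx].
    have [p [q [pU qU pq [px qx qy py]]]] := crossing_pair xm ym sx dy.
    apply/bigcupP; exists p => //; apply/bigcupP; exists q => //.
    by rewrite /F pq qy py !inE xy xA nbrs_sym qx nbrs_sym px.
  have cF p q : p \in U -> q \in U -> #|F p q| <= m.
    move=> pU qU; rewrite /F; case: ifP => [/and3P[pq qy py]|_]; last by rewrite cards0.
    apply: ltnW; apply: leq_ltn_trans (exc1 y q p yX1 _ _ pq qy py); rewrite ?inE ?pU ?qU //.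
    by rewrite subset_leq_card // !setSD // setSI // subsetUr.
  apply: leq_trans (card_bigcup_le (b := n * m) _) _ => [p pU|]; last by rewrite -mulnA leq_mul.
  apply: leq_trans (card_bigcup_le (b := m) _) _ => [q qU|]; last by rewrite leq_mul.
  exact: cF.
have sub_clique a' (Y : {set G}) : (forall Q, Q \subset Y -> is_clique Q -> #|Q| <= a') ->
    (forall Q, Q \subset Y -> is_clique Q -> #|Q| < k) ->
    forall Q, Q \subset Y -> is_clique Q -> #|Q| <= minn a' k.-1.
  by move=> h1 h2 Q sQ cQ; rewrite leq_min h1 //= -ltnS prednK // h2.
(* The minima with [k.-1] matter when [a] is [0] or [k]. *)
exists (minn a k.-1), (minn (k - a) k.-1), (Y1 :\: R0), (Y2 :\: X1), (R0 :|: X1); split.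
- by split; move: le_ak kpos; clear; lia.
- apply/subsetP=> w wm; rewrite !inE; move: (wm); rewrite inE => ->.
  by case: (cmpT w wm) => [->|->]; case: (w \in R0); case: (w \in X1); rewrite ?orbT.
- by split; rewrite (subset_trans (subsetDl _ _)) //; apply/subsetP=> w; rewrite inE => /andP[].
- rewrite (leq_trans (leq_card_setU _ _)) // leq_add // (leq_trans cR0) //.
  by rewrite leq_mul2r ltnS le_ak orbT.
split.
  apply: (sub_clique _ _ hR0) => Q sQ; apply: Y1k.
  exact: subset_trans sQ (subsetDl _ _).
apply: sub_clique.
- move=> Q sQ cQ; pose C := [set x in A | Q \subset nbrs x].
  have le_A : #|A| <= #|C| + #|Q| * (n * n * m).
    by apply: common_nbrs => y /(subsetP sQ); apply: few_A.
  have [|Q' [cQ' sQ' bQ']] := pA (A :\: C).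
    have sCA : C \subset A by apply/subsetP=> x; rewrite inE => /andP[].
    have -> : #|A :\: C| = #|A| - #|C| by rewrite cardsD (setIidPr sCA).
    rewrite /pack_size addn1 ltnS leq_subLR (leq_trans le_A) // leq_add2l.
    by rewrite leq_mul2r clique_le ?orbT.
  have inC x : x \in Q' -> Q \subset nbrs x.
    by move/(subsetP sQ'); rewrite !inE; case: (x \in A); case: (Q \subset _).
  have : #|Q' :|: Q| <= k.
    apply: clique_le; apply: clique_setU => // x y /inC /subsetP; apply.
  rewrite cardsU bQ'; have -> : Q' :&: Q = set0.
    apply/setP=> x; rewrite !inE; apply/negP=> /andP[/inC/subsetP sx /sx].
    by rewrite (negPf (nbrs_irr x)).
  by rewrite cards0 subn0; move: le_ak; clear; lia.
by move=> Q sQ; apply: Y2k; apply: subset_trans sQ (subsetDl _ _).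
Qed.

End Traces.

(** * Building and extending templates *)

Section Extension.
Variables (G : sgraph) (k d m z0 t tau delta D0 : nat).
Implicit Types (x y u v w : G) (A B F Q R S W Z D : {set G}).
Hypothesis clique_le : forall Q, is_clique Q -> #|Q| <= k.
Hypothesis ramsey : forall A, m <= #|A| ->
  exists I : {set G}, [/\ I \subset A, #|I| = d & stable I].
Hypothesis dsf : double_star_free d G.
Hypothesis z0_gt : m * k.+1 < z0.
Hypothesis z0_le : z0 <= t.
Hypothesis delta_eq : tau + t = delta.
Hypothesis D0_eq : 7 * k.+1 ^ 2 * delta = D0.
Hypothesis t_big : D0 * z0 <= t * t.

Lemma m_lt_z0 : m < z0.
Proof. by apply: leq_ltn_trans z0_gt; rewrite leq_pmulr. Qed.

(** Choose [w0] in [Co] with many nonneighbours [w] in [Co].  If such a [w] is not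
    exceptional, then the neighbours of [w] in [P i :&: nbrs w0] are near to its
    nonneighbours there; as [P i] is jointless, [w] misses few vertices of
    [P i :&: nbrs w0], with a bound [z0] that does not depend on [tau].  This
    keeps the nearness of a template from degrading as parts are added. *)
Lemma core_extend j (I : finType) (P : I -> {set G}) n (Co : {set G}) :
  j <= k -> template k m z0 t delta D0 j.+1 P -> #|union_parts P| <= n ->
  {in Co, forall w i, #|P i :\: nbrs w| <= tau} ->
  k.+1 * (exc_bound d m n.+1 + D0) < #|Co| ->
  exists P' : option I -> {set G}, template k m z0 t delta D0 j P'.
Proof.
move=> le_jk tP cU nearC /(many_nonnbrs clique_le)[w0 w0C big].
have [|X0 [/subsetP sX0 exc1 _] cX0] := exceptional_ex ramsey dsf
    (U := w0 |: union_parts P) (n := n.+1).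
  by rewrite cardsU1 -add1n leq_add // leq_b1.
pose D := (Co :\: nbrs w0) :\: X0.
have cD : D0 <= #|D|.
  have : #|(Co :\: nbrs w0) :&: X0| <= exc_bound d m n.+1.
    by apply: card_subset_le cX0; apply: subsetIr.
  by move/card_minus; rewrite -/D; move: big; clear; lia.
apply: (template_add clique_le z0_gt z0_le delta_eq D0_eq t_big le_jk tP cD
  (P' := fun i => P i :&: nbrs w0)) => i.
- exact: subsetIl.
- apply: card_subset_le (nearC _ w0C i); apply/subsetP=> x.
  by rewrite !inE; case: (x \in P i).
apply/nearP=> w; rewrite !inE => /and3P[wX0 w0w wC].
pose R := P i :&: nbrs w0 :&: nbrs w; pose Z := (P i :&: nbrs w0) :\: nbrs w.
have [bigP _ /(_ i) jP _] := tP.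
have w0U : w0 \in w0 |: union_parts P by exact: setU11.
have PU x : x \in P i -> x \in w0 |: union_parts P.
  by move=> xP; apply/setU1P; right; apply: in_union xP.
have sR : R \subset P i by rewrite /R -setIA subsetIl.
have sZ : Z \subset P i by rewrite /Z (subset_trans (subsetDl _ _)) ?subsetIl.
have nRZ : near m R Z.
  apply/nearP=> l /setIP[/setIP[lP lw0] lw]; apply: ltnW.
  have w0l : w0 \in nbrs l by rewrite nbrs_sym.
  have w0nw : w0 \notin nbrs w by rewrite nbrs_sym.
  apply: leq_ltn_trans (exc1 w l w0 wX0 (PU _ lP) w0U w0l lw w0nw).
  apply/subset_leq_card/subsetP=> z; rewrite !inE => /and4P[-> -> zP ->].
  by rewrite -in_setU1 PU.
have cRZ : #|P i :\: (R :|: Z)| <= slack delta j.+1.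
  apply: (@leq_trans tau); last by rewrite /slack mulSn -delta_eq -addnA leq_addr.
  apply: card_subset_le (nearC _ w0C i); apply/subsetP=> x; rewrite !inE.
  by case: (x \in nbrs w0); case: (x \in nbrs w); case: (x \in P i).
have /orP[cR|/ltnW//] := jointlessP jP sR sZ nRZ cRZ.
have h1 := card_inter (nearC _ w0C i).
have : #|P i :&: nbrs w0 :\: nbrs w| <= tau.
  by apply: card_subset_le (nearC _ wC i); rewrite setSD ?subsetIl.
move/card_inter; rewrite -/R; have := bigP i; rewrite /part_size mulnDl.
have : delta * 4 <= 4 * k.+1 * delta by rewrite mulnC leq_mul2r leq_pmulr ?orbT.
move: h1 cR delta_eq z0_le; clear; lia.
Qed.

(** A jointless subset of [priv u v] is a template with one part, and all but the
    exceptional vertices of [priv v u] are near to it. *)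
Lemma template_start u v : 0 < k -> v \in nbrs u -> D0 <= #|priv u v| ->
  exc_bound d m (D0 + 2) + D0 <= #|priv v u| ->
  exists P : option unit -> {set G}, template k m z0 t delta D0 k.-1 P.
Proof.
move=> kpos uv /subset_of_card[A0 sA0 cA0] bigB.
have tpos : 0 < t by move: z0_gt z0_le; clear; lia.
have dpos : 0 < delta by rewrite -delta_eq addn_gt0 tpos orbT.
have [||| Q [sQ bigQ jQ]] := @jointless_subset _ _ _ _ clique_le z0_gt
    (part_size k delta k) (slack delta k) A0.
- apply: (leq_trans z0_le); apply: leq_trans (delta_le_part k delta k).
  by rewrite -delta_eq leq_addl.
- rewrite cA0 /part_size /slack -D0_eq -mulnDl mulnA ltn_pmul2r // expnS expn1.
  by clear; nia.
- rewrite cA0 /part_size -D0_eq leq_mul2r expnS expn1; apply/orP; right.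
  by clear; nia.
have tQ : template k m z0 t delta D0 k (fun _ : unit => Q).
  by split=> // _; rewrite -cA0 subset_leq_card.
have [|X0 [/subsetP sX0 exc1 _] cX0] := exceptional_ex ramsey dsf
    (U := u |: (v |: A0)) (n := D0 + 2).
  by rewrite !cardsU1 cA0; case: (_ \notin _); case: (_ \notin _); rewrite /= ?addnA; lia.
have uU : u \in u |: (v |: A0) by rewrite setU11.
have vU : v \in u |: (v |: A0) by rewrite !inE eqxx orbT.
have cD : D0 <= #|priv v u :\: X0|.
  have : #|priv v u :&: X0| <= exc_bound d m (D0 + 2).
    by apply: card_subset_le cX0; apply: subsetIr.
  by move/card_minus; move: bigB; clear; lia.
rewrite -[k in template _ _ _ _ _ _ k](prednK kpos) in tQ.
apply: (template_add clique_le z0_gt z0_le delta_eq D0_eq t_big (leq_pred k) tQ cD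
  (P' := fun=> Q)) => _.
- exact: subxx.
- by rewrite setDv cards0.
apply: (near_le (ltnW m_lt_z0)); apply: (nearS (subxx _) sQ).
apply/nearP=> b; rewrite inE in_priv => /and4P[bX bu bnu bv]; apply: ltnW.
have uv' : u \in nbrs v by rewrite nbrs_sym.
have vb : v \in nbrs b by rewrite nbrs_sym.
have ub : u \notin nbrs b by rewrite nbrs_sym.
apply: leq_ltn_trans (exc1 b v u bX vU uU uv' vb ub).
apply/subset_leq_card/subsetP=> z; rewrite inE => /andP[zb zA0].
have := subsetP sA0 z zA0; rewrite in_priv => /and3P[zv zv' zu].
by rewrite !inE zb zv' zu zA0 !orbT.
Qed.

(** Take [u] of minimum degree and a neighbour [v] that misses many neighbours of
    [u]; as [v] has at least the degree of [u], it has as many private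
    neighbours. *)
Lemma rich_edge M x0 : (forall x, k.+1 * M < #|nbrs x|) ->
  exists u v, [/\ v \in nbrs u, M <= #|priv u v| & M <= #|priv v u|].
Proof.
move=> mindeg; case: (arg_minnP (fun x => #|nbrs x|) (isT : xpredT x0)) => u _ minu.
have [v uv big] := many_nonnbrs clique_le (mindeg u).
have priv_ge x y : #|nbrs x :\: nbrs y| <= (#|priv x y|).+1.
  have -> : priv x y = nbrs x :\: nbrs y :\ y.
    by apply/setP=> z; rewrite /priv !inE negb_or; case: (z == y); rewrite ?andbF.
  by rewrite (cardsD1 y (nbrs x :\: nbrs y)) -add1n leq_add2r leq_b1.
exists u, v; split=> //; first by have := leq_trans big (priv_ge u v).
have := minu v isT.
rewrite -(cardsID (nbrs v) (nbrs u)) -(cardsID (nbrs u) (nbrs v)) setIC leq_add2l.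
by move/(leq_trans big)/leq_trans/(_ (priv_ge v u)).
Qed.

End Extension.

(** * Colouring *)

Section Coloring.
Variable G : sgraph.
Implicit Types (x y u v w : G) (F Q R S W Y : {set G}) (c : G -> nat).

(** Colours are natural numbers, so that colourings can be restricted and combined
    without casts. *)
Definition proper S c n := {in S, forall x, c x < n} /\
  {in S &, forall x y, y \in nbrs x -> c x != c y}.
Definition colours S n := exists c, proper S c n.

Lemma coloursS S S' n : S \subset S' -> colours S' n -> colours S n.
Proof.
move=> /subsetP sS [c [c_lt cP]]; exists c; split=> [x /sS|x y /sS xS /sS yS].
  exact: c_lt.
exact: cP.
Qed.

Lemma colours_le S n n' : n <= n' -> colours S n -> colours S n'.
Proof.
by move=> le_n [c [c_lt cP]]; exists c; split=> // x /c_lt /leq_trans; apply.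
Qed.

Lemma colours_card S : colours S #|S|.
Proof.
exists (fun x => index x (enum S)); split=> [x xS|x y xS yS xy].
  by rewrite cardE index_mem mem_enum.
apply: contraTneq xy => /(congr1 (nth x (enum S))).
by rewrite !nth_index ?mem_enum // => ->; apply: nbrs_irr.
Qed.

Lemma colours_setU S S' n n' : colours S n -> colours S' n' -> colours (S :|: S') (n + n').
Proof.
move=> [c [c_lt cP]] [c' [c'_lt c'P]].
exists (fun x => if x \in S then c x else n + c' x); split=> [x|x y].
  by rewrite inE; case: ifP => [/c_lt xn _|_ /= /c'_lt xn]; [apply: ltn_addr|rewrite ltn_add2l].
rewrite !inE; case: ifP => [xS _|_ /= xS']; case: ifP => [yS _|_ /= yS'] xy.
- exact: cP.
- by rewrite neq_ltn ltn_addr ?c_lt.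
- by rewrite neq_ltn (@ltn_addr _ n) ?orbT ?c_lt.
by rewrite eqn_add2l c'P.
Qed.

Lemma free_color c F q : #|F| <= q -> exists2 a, a <= q & {in F, forall y, c y != a}.
Proof.
move=> cF; pose used := [seq c y | y <- enum F].
have [/hasP[a]|/hasPn all_used] := boolP (has (fun a => a \notin used) (iota 0 q.+1)).
  rewrite mem_iota ltnS => /= aq aF; exists a => // y yF.
  by apply: contraNneq aF => <-; apply: map_f; rewrite mem_enum.
have sub : {subset iota 0 q.+1 <= used} by move=> a /all_used; rewrite negbK.
by have := uniq_leq_size (iota_uniq 0 q.+1) sub; rewrite size_iota size_map -cardE ltnNge cF.
Qed.

(** The vertices of [F] are recoloured one at a time; each has at most [q]
    neighbours, so one of the first [q.+1] colours is free. *)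
Lemma recolor S c n F q : proper S c n -> q < n ->
  {in F, forall x, #|nbrs x :&: S| <= q} ->
  exists2 c', proper S c' n & {in F, forall x, c' x <= q}.
Proof.
move=> cS qn degF.
suff [c' h1 h2] : exists2 c', proper S c' n & {in enum F, forall x, c' x <= q}.
  by exists c' => // x xF; apply: h2; rewrite mem_enum.
have : {subset enum F <= F} by move=> x; rewrite mem_enum.
elim: (enum F) => [|x s IHs] sub; first by exists c.
have [|c' [lt_c' c'P] h2] := IHs; first by move=> y ys; apply: sub; rewrite inE ys orbT.
have xF : x \in F by apply: sub; rewrite mem_head.
have [a aq aP] := free_color c' (degF x xF).
exists (fun y => if y == x then a else c' y).
  split=> [y yS|y z yS zS].
    by case: ifP => _; [apply: leq_ltn_trans qn | apply: lt_c'].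
  case: (eqVneq y x) => [->|yx]; case: (eqVneq z x) => [->|zx] yz.
  - by rewrite (negPf (nbrs_irr x)) in yz.
  - by rewrite eq_sym aP // inE yz.
  - by rewrite aP // inE nbrs_sym yz.
  exact: c'P.
by move=> y; rewrite inE; case: eqP => //= _; apply: h2.
Qed.

(** Only the colours in [L] occur on the neighbours of [Y], so [Y] can be coloured
    with the remaining ones. *)
Lemma colours_glue S c n Y n' (B : {set G}) (L : seq nat) :
  proper S c n -> colours Y n' -> S :|: Y = setT ->
  {in S & Y, forall x y, y \in nbrs x -> x \in B} -> {in B, forall x, c x \in L} ->
  n' + size L <= n -> colours setT n.
Proof.
move=> [c_lt cP] [c' [c'_lt c'P]] SY bd cB le_n.
pose av := [seq a <- iota 0 n | a \notin L].
have av_size : n' <= size av.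
  have : n <= size av + size L; last by lia.
  rewrite -{1}(size_iota 0 n) -(count_predC (fun a => a \notin L) (iota 0 n)).
  rewrite size_filter leq_add2l.
  rewrite -size_filter; apply: uniq_leq_size; first by rewrite filter_uniq ?iota_uniq.
  by move=> a; rewrite mem_filter /= negbK => /andP[].
have av_nth y : y \in Y -> nth 0 av (c' y) \in av.
  by move=> yY; rewrite mem_nth // (leq_trans (c'_lt y yY)).
have inY x : x \notin S -> x \in Y.
  by move=> xS; have := in_setT x; rewrite -SY inE (negPf xS).
exists (fun x => if x \in S then c x else nth 0 av (c' x)).
have cross x y : x \in S -> y \notin S -> y \in nbrs x -> c x != nth 0 av (c' y).
  move=> xS /inY yY xy; have := av_nth y yY; rewrite mem_filter => /andP[+ _].
  by apply: contraNneq => <-; apply: cB; apply: bd xS yY xy.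
split=> [x _|x y _ _ xy].
  case: ifP => [/c_lt//|/negbT/inY/av_nth]; rewrite mem_filter mem_iota => /andP[_].
  by rewrite add0n.
case: ifP => xS; case: ifP => yS.
- exact: cP.
- by apply: cross; rewrite ?yS.
- by rewrite eq_sym; apply: cross; rewrite ?xS // nbrs_sym.
have xY := inY x (negbT xS); have yY := inY y (negbT yS).
rewrite nth_uniq ?(leq_trans (c'_lt _ _)) ?filter_uniq ?iota_uniq //.
exact: c'P.
Qed.

Lemma colours_low_degree u n : colours (~: [set u]) n -> #|nbrs u| < n -> colours setT n.
Proof.
move=> [c [c_lt cP]] deg; have npos : 0 < n by apply: leq_ltn_trans deg.
have [|a a_lt aP] := free_color c (F := nbrs u) (q := n.-1); first by rewrite -ltnS prednK.
exists (fun x => if x == u then a else c x).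
have inS x : x != u -> x \in ~: [set u] by rewrite !inE.
split=> [x _|x y _ _].
  by case: ifP => [_|/negbT/inS/c_lt//]; rewrite -(prednK npos) ltnS.
case: (eqVneq x u) => [->|xu]; case: (eqVneq y u) => [->|yu] xy.
- by rewrite (negPf (nbrs_irr u)) in xy.
- by rewrite eq_sym aP.
- by rewrite aP // nbrs_sym.
by apply: cP xy; apply: inS.
Qed.

End Coloring.

(** * The induction step *)

Section Constants.
Variables d k : nat.
Definition stable_size := k.+2 ^ d.
Definition joint_size := stable_size * k.+1 + 1.
(** This multiple of [joint_size] is what makes [miss_max_big] hold, where
    [part_max] is itself proportional to [miss_max]. *)
Definition miss_max := joint_size * (7 * k.+1 ^ 2 * (2 * stable_size + 6)).
Definition pure_max := joint_size + miss_max.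
Definition blind_min := (stable_size + 2) * pure_max + stable_size.
Definition step := blind_min + miss_max.
Definition part_max := 7 * k.+1 ^ 2 * step.
Definition union_max := k.+1 * part_max.
Definition exc_max := exc_bound d stable_size union_max.
Definition core_max := k.+1 * (exc_bound d stable_size union_max.+1 + part_max).
Definition split_max := split_bound k d stable_size union_max.
Definition rich_min := exc_bound d stable_size (part_max + 2) + part_max.
(** The number of colours spent on exceptional vertices, on the core and on the
    recoloured far vertices; it also bounds from above the degrees that are too
    small to give a template. *)
Definition loss :=
  split_max + 2 * (exc_max + core_max) + 2 * stable_size + k.+1 * rich_min + 2.

Lemma joint_size_gt : stable_size * k.+1 < joint_size.
Proof. by rewrite /joint_size addn1. Qed.

Lemma joint_size_le : joint_size <= miss_max.
Proof. by rewrite /miss_max leq_pmulr // !muln_gt0 addn_gt0 orbT ?expn_gt0. Qed.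

Lemma miss_max_big : part_max * joint_size <= miss_max * miss_max.
Proof.
have m_t : stable_size <= miss_max.
  by apply: leq_trans joint_size_le; rewrite /joint_size mulnS -addnA leq_addr.
have d_t : step <= (2 * stable_size + 6) * miss_max.
  rewrite /step /blind_min /pure_max; move: m_t joint_size_le.
  by move: stable_size joint_size miss_max; clear; nia.
rewrite {2}/miss_max mulnA [miss_max * joint_size]mulnC -[joint_size * miss_max * _]mulnA.
rewrite [part_max * joint_size]mulnC leq_mul2l.
by rewrite [miss_max * _]mulnC -mulnA /part_max leq_mul2l d_t orbT orbT.
Qed.
End Constants.

Section MainStep.
Variables (G : sgraph) (d k : nat) (f : nat -> nat).
Implicit Types (x y u v w : G) (Q R S W Y : {set G}).
Hypothesis k_gt0 : 0 < k.
Hypothesis clique_le : forall Q, is_clique Q -> #|Q| <= k.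
Hypothesis dsf : double_star_free d G.
Hypothesis f_slack : forall a b, a + b <= k -> a < k -> b < k ->
  f a + f b + loss d k <= f k.
Hypothesis IH : forall S, S != setT -> forall k',
  (forall Q, Q \subset S -> is_clique Q -> #|Q| <= k') -> colours S (f k').
Hypothesis min_degree : forall u, f k <= #|nbrs u|.

Local Notation m := (stable_size d k).
Let ramsey (A : {set G}) : m <= #|A| ->
  exists I : {set G}, [/\ I \subset A, #|I| = d & stable I].
Proof. exact: stable_subset. Qed.

Local Notation tmpl := (template k m (joint_size d k) (miss_max d k) (step d k) (part_max d k)).

Lemma loss_le : loss d k <= f k.
Proof. by apply: leq_trans (f_slack (a := 0) (b := 0) _ _ _); rewrite ?leq_addl. Qed.

Lemma proper_setT S x : x \notin S -> S != setT.
Proof. by apply: contraNneq => ->; rewrite inE. Qed.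

(** Colour the complement of the middle by induction and recolour with at most
    [q.+1] colours the far vertices that have middle neighbours.  Then few
    colours occur on the neighbours of the middle, because the other neighbours
    lie in the small set [E]. *)
Lemma colours_of_template j (I : finType) (P : I -> {set G}) X : tmpl j P -> 1 < #|I| ->
  #|union_parts P| <= union_max d k -> exceptional m (union_parts P) X -> #|X| <= exc_max d k ->
  #|[set w | (w \notin X) && (missed (blind_min d k) P w == set0)]| <= core_max d k ->
  colours [set: G] (f k).
Proof.
move=> tP I1 cU excX cX; set core := [set w | _] => cC.
pose fr := far (blind_min d k) P X; pose mi := mid (blind_min d k) P X.
pose E := X :|: core.
have cE : #|E| <= exc_max d k + core_max d k by rewrite (leq_trans (leq_card_setU _ _)) ?leq_add.
have lossE : split_max d k + (2 * (exc_max d k + core_max d k) + 2 * m + 2) <= loss d k.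
  by rewrite /loss; clear; lia.
have notmid x : x \notin mi -> (x \in fr) || (x \in E).
  rewrite !inE; case: (x \in X) => //=; rewrite ?orbT //.
  by case: eqP => //= _; case: eqP.
have [u0 u0U few0] := few_far_start clique_le ramsey dsf (joint_size_gt d k) (joint_size_le d k)
  erefl erefl erefl tP I1 excX.
have u0X : u0 \in X by case: excX => /subsetP sUX _ _; apply: sUX.
have mid_neq0 : mi != set0.
  apply: contraTneq (leq_trans loss_le (min_degree u0)) => mi0; rewrite -ltnNge.
  have sN : nbrs u0 \subset (nbrs u0 :&: fr) :|: E.
    apply/subsetP=> x xN; have := notmid x; rewrite mi0 inE => /(_ isT).
    by rewrite !in_setU in_setI xN.
  apply: leq_ltn_trans (subset_leq_card sN) _.
  apply: leq_ltn_trans (leq_card_setU _ _) _.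
  by move: few0 cE lossE; rewrite -/fr; clear; lia.
have [a [b [Y1 [Y2 [R [[ab ak bk] sY [sY1 sY2] cR [clY1 clY2]]]]]]] :=
  mid_split clique_le ramsey dsf (joint_size_gt d k) erefl erefl erefl tP excX cU mid_neq0.
have Yproper Y : Y \subset mi -> Y != setT.
  by move=> sYm; apply: (proper_setT (x := u0)); apply/negP=> /(subsetP sYm); rewrite inE u0X.
have colY : colours mi (f a + f b + split_max d k).
  apply: (coloursS sY); apply: colours_setU; last exact: (colours_le cR (colours_card R)).
  by apply: colours_setU; apply: IH => //; apply: Yproper.
have [z zm] := set0Pn _ mid_neq0.
have S_proper : ~: mi != setT by apply: (proper_setT (x := z)); rewrite inE zm.
have [c cP] := IH S_proper (fun Q _ => @clique_le Q).
pose F := [set x in fr | [exists y in mi, y \in nbrs x]].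
pose q := 2 * m + (exc_max d k + core_max d k).
have degF : {in F, forall x, #|nbrs x :&: ~: mi| <= q}.
  move=> x; rewrite inE => /andP[xf /exists_inP[y ym xy]].
  have [yX /set0Pn[i iT] yT] := midP _ _ _ _ ym.
  have := far_degree ramsey dsf (joint_size_gt d k) erefl erefl erefl tP I1 excX
    xf xy yX yT iT.
  have sN : nbrs x :&: ~: mi \subset (nbrs x :&: fr) :|: E.
    by apply/subsetP=> w; rewrite inE inE => /andP[xw /notmid]; rewrite !in_setU in_setI xw.
  have := leq_trans (subset_leq_card sN) (leq_card_setU _ _).
  by rewrite -/fr /q; move: cE; clear; lia.
have q_lt : q < f k by apply: leq_trans loss_le; rewrite /q; move: lossE; clear; lia.
have [c' c'P c'F] := recolor cP q_lt degF.
apply: (colours_glue (B := E :|: F) (L := [seq c' x | x <- enum E] ++ iota 0 q.+1) c'P colY).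
- by rewrite setUC setUCr.
- move=> x y; rewrite inE => /notmid/orP[xf|xE] ym xy; rewrite inE; last by rewrite xE.
  by apply/orP; right; rewrite inE xf; apply/exists_inP; exists y.
- move=> x; rewrite inE mem_cat mem_iota ltnS => /orP[xE|xF].
    by rewrite map_f // mem_enum.
  by rewrite c'F ?orbT.
rewrite size_cat size_map size_iota -cardE.
have := f_slack ab ak bk; rewrite /q.
by move: cE lossE; move: (f a) (f b) (f k) (loss d k) (split_max d k) #|E|; clear; lia.
Qed.

(** Parts are added as long as the core is large, and there are never more than
    [k] of them. *)
Lemma template_loop j (I : finType) (P : I -> {set G}) :
  1 < #|I| -> #|I| + j = k.+1 -> tmpl j P -> colours [set: G] (f k).
Proof.
elim: j I P => [|j IHj] I P I1 Ij tP.
  have := template_le clique_le (joint_size_gt d k) (joint_size_le d k) erefl tP.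
  by rewrite -Ij addn0 leqnn => /(_ isT); rewrite -ltnS -Ij addn0 ltnn.
have cU : #|union_parts P| <= union_max d k.
  rewrite /union_parts; have -> : \bigcup_i P i = \bigcup_(i in setT) P i.
    by apply: eq_bigl => i; rewrite inE.
  apply: leq_trans (card_bigcup_le (b := part_max d k) _) _.
    by move=> i _; case: tP.
  by rewrite leq_mul2r cardsT -Ij leq_addr orbT.
have [X excX cX] := exceptional_ex ramsey dsf cU.
pose core := [set w | (w \notin X) && (missed (blind_min d k) P w == set0)].
have [small|big] := leqP #|core| (core_max d k).
  exact: colours_of_template tP I1 cU excX cX small.
have jk : j <= k by lia.
have near_core : {in core, forall w i, #|P i :\: nbrs w| <= blind_min d k}.
  move=> w; rewrite inE => /andP[_ /eqP T0] i.
  by apply: ltnW; rewrite ltnNge -in_missed T0 inE.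
have [P' tP'] := core_extend clique_le ramsey dsf
  (joint_size_gt d k) (joint_size_le d k) erefl erefl
  (miss_max_big d k) jk tP cU near_core big.
by apply: IHj tP'; rewrite card_option ?ltnS ?(ltnW I1) // -Ij addSnnS.
Qed.

Lemma colours_of_min_degree x0 : colours [set: G] (f k).
Proof.
have deg x : k.+1 * rich_min d k < #|nbrs x|.
  by apply: leq_trans (min_degree x); apply: leq_trans loss_le; rewrite /loss; clear; lia.
have [u [v [uv bigu bigv]]] := rich_edge clique_le x0 deg.
have bigu' : part_max d k <= #|priv u v| by apply: leq_trans bigu; rewrite leq_addl.
have [P tP] := template_start clique_le ramsey dsf
  (joint_size_gt d k) (joint_size_le d k) erefl erefl
  (miss_max_big d k) k_gt0 uv bigu' bigv.
by apply: template_loop tP; rewrite card_option card_unit // add2n prednK.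
Qed.

End MainStep.

(** * Induction on the number of vertices *)

Lemma card_induced (G : sgraph) (S : {set G}) : #|induced S| = #|S|.
Proof. exact: card_sig. Qed.

Section Embedding.
Variables (H G : sgraph) (phi : H -> G).
Hypothesis phi_inj : injective phi.
Hypothesis phi_adj : forall x y, adj (phi x) (phi y) = adj x y.

Lemma phi_nbrs x y : (phi y \in nbrs (phi x)) = (y \in nbrs x).
Proof. by rewrite !in_nbrs phi_adj. Qed.

Lemma priv_imset x y (A : {set H}) : A \subset priv x y ->
  phi @: A \subset priv (phi x) (phi y).
Proof.
move=> /subsetP sA; apply/subsetP=> _ /imsetP[a /sA + ->].
by rewrite !in_priv !phi_nbrs (inj_eq phi_inj).
Qed.

(** Used for the inclusion of an induced subgraph. *)
Lemma double_star_free_sub d : double_star_free d G -> double_star_free d H.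
Proof.
move=> dsf x y A B xy cA cB sA sB; apply/negP=> /anticompleteP st.
have cA' : #|phi @: A| = d by rewrite card_imset.
have cB' : #|phi @: B| = d by rewrite card_imset.
have xy' : phi y \in nbrs (phi x) by rewrite phi_nbrs.
have /negP[] := dsf _ _ _ _ xy' cA' cB' (priv_imset sA) (priv_imset sB).
rewrite -imsetU; apply/anticompleteP=> _ _ /imsetP[a aA ->] /imsetP[b bB ->].
by rewrite phi_nbrs st.
Qed.

Lemma clique_imset Q : is_clique Q -> is_clique (phi @: Q).
Proof.
move/is_cliqueP=> cQ; apply/is_cliqueP=> _ _ /imsetP[a aQ ->] /imsetP[b bQ ->].
by rewrite (inj_eq phi_inj) phi_nbrs; apply: cQ.
Qed.

Lemma induced_of_embedding : exists S : {set G}, isomorphic (induced S) H.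
Proof.
pose S := [set phi h | h in H]; exists S.
have phiS h : phi h \in S by apply: imset_f.
pose g h : induced S := exist _ (phi h) (phiS h).
have g_inj : injective g by move=> h h' /(congr1 val) /phi_inj.
have [f gK fK] : bijective g.
  by apply: inj_card_bij g_inj _; rewrite card_induced card_imset.
exists f; split; first by exists g.
by move=> x y; rewrite -phi_adj -{2}(fK x) -{2}(fK y).
Qed.

End Embedding.

(** By induction on the number of vertices: a vertex of degree below [f k] can be
    coloured last, and otherwise [colours_of_min_degree] applies. *)
Lemma colours_all (d : nat) (f : nat -> nat) :
  (forall k a b, 0 < k -> a + b <= k -> a < k -> b < k -> f a + f b + loss d k <= f k) ->
  forall (G : sgraph) k, double_star_free d G ->
    (forall Q : {set G}, is_clique Q -> #|Q| <= k) -> colours [set: G] (f k).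
Proof.
move=> slack G; have [n] := ubnP #|G|; elim: n G => // n IHn G ltGn k dsf clique_le.
have [x0 _|G0] := pickP (fun _ : G => true); last first.
  by exists (fun=> 0); split=> x; have := G0 x.
have k_gt0 : 0 < k.
  apply: leq_trans (clique_le [set x0] _); first by rewrite cards1.
  by apply/is_cliqueP=> x y /set1P-> /set1P->; rewrite eqxx.
have IH (S : {set G}) : S != setT -> forall k',
    (forall Q : {set G}, Q \subset S -> is_clique Q -> #|Q| <= k') -> colours S (f k').
  move=> ST k' clS; have val_adj (u v : induced S) : adj (val u) (val v) = adj u v by [].
  have valI : injective (val : induced S -> G) := val_inj.
  have ltSn : #|induced S| < n.
    rewrite card_induced; apply: leq_trans (ltGn : #|G| <= n).
    by rewrite -[#|G|]cardsT proper_card // properT.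
  have [|c [c_lt cP]] := IHn _ ltSn k' (double_star_free_sub valI val_adj dsf).
    move=> Q cQ; rewrite -(card_imset _ valI); apply: clS.
      by apply/subsetP=> _ /imsetP[u _ ->]; apply: valP.
    exact: clique_imset val_adj _ cQ.
  exists (fun x => if insub x is Some u then c (u : induced S) else 0); split=> [x xS|x y xS yS].
    by rewrite insubT; apply: c_lt.
  by rewrite !insubT => xy; apply: cP; rewrite ?inE // -(phi_nbrs val_adj).
have [u low|high] := pickP (fun u : G => #|nbrs u| < f k).
  have uT : ~: [set u] != setT by apply: (proper_setT (x := u)); rewrite !inE eqxx.
  exact: colours_low_degree (IH _ uT k (fun Q _ => @clique_le Q)) low.
have slack_k a b : a + b <= k -> a < k -> b < k -> f a + f b + loss d k <= f k.
  exact: slack.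
have deg (u : G) : f k <= #|nbrs u| by have /negbT := high u; rewrite -leqNgt.
exact: (colours_of_min_degree k_gt0 clique_le dsf slack_k IH deg x0).
Qed.

(** * Polynomial bounds *)

Definition poly_bounded (p : nat -> nat) := exists B e, forall k, 0 < k -> p k <= B * k ^ e.

Lemma poly_const b : poly_bounded (fun=> b).
Proof. by exists b, 0 => k _; rewrite muln1. Qed.

Lemma poly_id : poly_bounded id.
Proof. by exists 1, 1 => k _; rewrite mul1n expn1. Qed.

Lemma poly_add p q : poly_bounded p -> poly_bounded q -> poly_bounded (fun k => p k + q k).
Proof.
move=> [B [e hp]] [B' [e' hq]]; exists (B + B'), (e + e') => k k0.
rewrite mulnDl leq_add // ?(leq_trans (hp k k0)) ?(leq_trans (hq k k0)) //.
  by rewrite leq_mul2l leq_pexp2l ?orbT // leq_addr.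
by rewrite leq_mul2l leq_pexp2l ?orbT // leq_addl.
Qed.

Lemma poly_mul p q : poly_bounded p -> poly_bounded q -> poly_bounded (fun k => p k * q k).
Proof.
move=> [B [e hp]] [B' [e' hq]]; exists (B * B'), (e + e') => k k0.
by rewrite expnD mulnACA leq_mul ?hp ?hq.
Qed.

Lemma poly_exp p c : poly_bounded p -> poly_bounded (fun k => p k ^ c).
Proof.
move=> hp; elim: c => [|c IHc]; first exact: (poly_const 1).
have [B [e h]] := poly_mul hp IHc; exists B, e => k k0; rewrite expnS; exact: h.
Qed.

Lemma poly_succ p : poly_bounded p -> poly_bounded (fun k => (p k).+1).
Proof.
move=> hp; have [B [e h]] := poly_add (poly_const 1) hp.
by exists B, e => k k0; rewrite -add1n; apply: h.
Qed.

Ltac poly := repeat first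
  [ apply: poly_const | apply: poly_id | assumption | apply: poly_succ
  | apply: poly_add | apply: poly_mul | apply: poly_exp ].

Lemma poly_exc_bound d p q : poly_bounded p -> poly_bounded q ->
  poly_bounded (fun k => exc_bound d (p k) (q k)).
Proof. by move=> hp hq; rewrite /exc_bound; poly. Qed.

Lemma loss_poly d : poly_bounded (loss d).
Proof.
have hm : poly_bounded (stable_size d) by rewrite /stable_size; poly.
have hz : poly_bounded (joint_size d) by rewrite /joint_size; poly.
have ht : poly_bounded (miss_max d) by rewrite /miss_max; poly.
have hmu : poly_bounded (pure_max d) by rewrite /pure_max; poly.
have htau : poly_bounded (blind_min d) by rewrite /blind_min; poly.
have hdelta : poly_bounded (step d) by rewrite /step; poly.
have hD : poly_bounded (part_max d) by rewrite /part_max; poly.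
have hn : poly_bounded (union_max d) by rewrite /union_max; poly.
have hexc : poly_bounded (exc_max d) by apply: poly_exc_bound.
have hcore : poly_bounded (core_max d).
  by rewrite /core_max; poly; apply: poly_exc_bound; poly.
have hpack : poly_bounded (fun k => pack_size k (stable_size d k) (union_max d k)).
  by rewrite /pack_size; poly.
have hsplit : poly_bounded (split_max d).
  by rewrite /split_max /split_bound; poly; apply: poly_exc_bound; poly.
have hrich : poly_bounded (rich_min d).
  by rewrite /rich_min; poly; apply: poly_exc_bound; poly.
by rewrite /loss; poly.
Qed.

(** Since [a] and [b] are less than [k], the sum [a ^ e.+2 + b ^ e.+2] is at most
    [k * k.-1 ^ e.+1], which is at most [k.-1 * k ^ e.+1]. *)
Lemma pow_slack e k a b : 0 < k -> a + b <= k -> a < k -> b < k ->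
  a ^ e.+2 + b ^ e.+2 + k ^ e.+1 <= k ^ e.+2.
Proof.
case: k => // k _ abk ak bk.
have mono c c' e' : c <= c' -> c ^ e' <= c' ^ e'.
  by case: e' => // e' le_c; rewrite leq_exp2r.
have le_pow c : c < k.+1 -> c ^ e.+2 <= c * k ^ e.+1.
  by move=> ck; rewrite [c ^ e.+2]expnS leq_mul2l mono ?orbT.
apply: (@leq_trans (k.+1 * k ^ e.+1 + k.+1 ^ e.+1)).
  rewrite leq_add2r; apply: leq_trans (leq_add (le_pow a ak) (le_pow b bk)) _.
  by rewrite -mulnDl leq_mul2r abk orbT.
have le_k : k.+1 * k ^ e.+1 <= k * k.+1 ^ e.+1.
  by rewrite [k ^ e.+1]expnS [k.+1 ^ e.+1]expnS mulnCA !leq_mul2l mono ?orbT.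
by rewrite [k.+1 ^ e.+2]expnS mulSn addnC leq_add2l.
Qed.

(** * Double stars *)

Section DoubleStar.
Variable H : sgraph.
Implicit Types (u v w c : H).
Hypothesis H_conn : connected_graph H.

Lemma nbr_unique v u w : degree v <= 1 -> u \in nbrs v -> w \in nbrs v -> u = w.
Proof.
rewrite /degree => /card_le1_eqP h; rewrite !in_nbrs => vu vw.
by apply: h; rewrite inE.
Qed.

Lemma closed_whole (a : {set H}) u v :
  (forall x y, x \in a -> y \in nbrs x -> y \in a) -> u \in a -> v \in a.
Proof.
move=> a_cl ua; have cl : closed (@adj H) (mem a).
  move=> x y /= xy; apply/idP/idP => [xa|ya].
    by apply: a_cl xa _; rewrite in_nbrs.
  by apply: a_cl ya _; rewrite in_nbrs adj_sym.
by rewrite -(closed_connect cl (H_conn.2 u v)).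
Qed.

Lemma has_nbr u v : u != v -> exists w, w \in nbrs u.
Proof.
move=> uv; apply/existsP; apply: contraNT uv => /existsPn noN.
have : v \in [set u].
  apply: (closed_whole (u := u)); rewrite ?inE // => x y /set1P-> yu.
  by have := noN y; rewrite yu.
by rewrite inE eq_sym.
Qed.

(** Two vertices of degree at least two are adjacent: otherwise one of them forms,
    with its neighbours, which are all leaves, a connected component. *)
Lemma double_star_center : #|[set x : H | 1 < degree x]| <= 2 -> 1 < #|H| ->
  exists c1 c2, c2 \in nbrs c1 /\ forall v, v != c1 -> v != c2 -> degree v <= 1.
Proof.
set D := [set x | _] => D2 H2.
have nbr c : exists w, w \in nbrs c.
  have : 0 < #|[set~ c]| by rewrite cardsC1; case: #|H| H2 => [|[]].
  by case/card_gt0P=> v; rewrite !inE eq_sym; apply: has_nbr.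
have notD v : v \notin D -> degree v <= 1 by rewrite inE -leqNgt.
have [D0|[c cD]] := set_0Vmem D.
  have /card_gt0P[v _] := H_conn.1; have [w vw] := nbr v.
  by exists v, w; split=> // x _ _; apply: notD; rewrite D0 inE.
have [Dc|[c' c'D]] := set_0Vmem (D :\ c).
  have [w cw] := nbr c; exists c, w; split=> // x xc _; apply: notD.
  by apply/negP=> xD; have : x \in D :\ c; [rewrite in_setD1 xc | rewrite Dc inE].
have [c'c c'D'] := setD1P c'D.
have Dcc v : v != c -> v != c' -> degree v <= 1.
  move=> vc vc'; apply: notD; apply/negP=> vD; move: D2; rewrite leqNgt => /negP; apply.
  have sD : [set c; c'; v] \subset D.
    by apply/subsetP=> x; rewrite !in_setU !in_set1 => /orP[/orP[]|] /eqP->.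
  apply: leq_trans (subset_leq_card sD).
  by rewrite setUC cardsU1 cards2 !in_set2 negb_or vc vc' eq_sym c'c.
have [cc'|ncc'] := boolP (c' \in nbrs c); first by exists c, c'.
have : c' \in c |: nbrs c.
  apply: (closed_whole (u := c)); last exact: setU11.
  move=> x y /setU1P[->|xc] xy; first by rewrite inE xy orbT.
  have deg_x : degree x <= 1.
    by apply: Dcc; apply: contraTneq xc => ->; rewrite ?nbrs_irr.
  by rewrite (nbr_unique deg_x xy (_ : c \in nbrs x)) ?setU11 // nbrs_sym.
by rewrite !inE (negPf c'c) (negPf ncc').
Qed.

(** Two adjacent leaves would form a connected component. *)
Lemma leaf_nbr c1 c2 v :
  (forall w, w != c1 -> w != c2 -> degree w <= 1) ->
  v != c1 -> v != c2 -> c1 \notin nbrs v -> c2 \in nbrs v.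
Proof.
move=> deg vc1 vc2 c1v; apply: contraT => c2v.
have [u vu] := has_nbr vc1.
have uc1 : u != c1 by apply: contraTneq vu => ->.
have uc2 : u != c2 by apply: contraTneq vu => ->.
have : c1 \in [set u; v].
  apply: (closed_whole (u := v)); last by rewrite !inE eqxx orbT.
  have uv : v \in nbrs u by rewrite nbrs_sym.
  move=> x y /set2P[->|->] xy.
    by rewrite (nbr_unique (deg u uc1 uc2) xy uv) !inE eqxx orbT.
  by rewrite (nbr_unique (deg v vc1 vc2) xy vu) !inE eqxx.
by rewrite !inE eq_sym (negPf uc1) eq_sym (negPf vc1).
Qed.

(** Given a balanced double star in [G], map the two centres of [H] to its centres
    and the leaves of [H] injectively to leaves on the corresponding side.  With
    [#|H|] leaves on each side there is enough room. *)
Lemma free_double_star_free (G : sgraph) :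
  #|[set x : H | 1 < degree x]| <= 2 -> graph_free H G -> double_star_free #|H| G.
Proof.
move=> D2 HG x y A B xy cA cB sA sB; apply/negP=> /anticompleteP st.
suff [phi phi_inj phi_adj] : exists2 phi : H -> G, injective phi &
    forall u v, adj (phi u) (phi v) = adj u v.
  by have [S] := induced_of_embedding phi_inj phi_adj; apply: HG.
have [H1|H2] := leqP #|H| 1.
  have /card_le1_eqP Heq := H1.
  have eqH u v : u = v by apply: Heq.
  exists (fun=> x) => u v; first by [].
  by rewrite (eqH u v) !adj_irrefl.
have [c1 [c2 [c12 deg]]] := double_star_center D2 H2.
have c21 : c2 != c1 by apply: contraTneq c12 => ->; apply: nbrs_irr.
have nthA a : nth x (enum A) (enum_rank (a : H)) \in A.
  by rewrite -mem_enum mem_nth // -cardE cA.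
have nthB a : nth x (enum B) (enum_rank (a : H)) \in B.
  by rewrite -mem_enum mem_nth // -cardE cB.
have nthAB (C : {set G}) (a b : H) : #|C| = #|H| ->
    nth x (enum C) (enum_rank a) = nth x (enum C) (enum_rank b) -> a = b.
  move=> cC /eqP; rewrite nth_uniq ?enum_uniq -?cardE ?cC //.
  by move/eqP/val_inj/enum_rank_inj.
pose phi v := if v == c1 then x else if v == c2 then y else
  if c1 \in nbrs v then nth x (enum A) (enum_rank v) else nth x (enum B) (enum_rank v).
pose leaf v := (v != c1) && (v != c2).
have phi1 : phi c1 = x by rewrite /phi eqxx.
have phi2 : phi c2 = y by rewrite /phi (negPf c21) eqxx.
have inA v : leaf v -> c1 \in nbrs v -> phi v \in A /\ phi v = nth x (enum A) (enum_rank v).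
  by case/andP=> /negPf v1 /negPf v2 vc; rewrite /phi v1 v2 vc.
have inB v : leaf v -> c1 \notin nbrs v -> phi v \in B /\ phi v = nth x (enum B) (enum_rank v).
  by case/andP=> /negPf v1 /negPf v2 /negPf vc; rewrite /phi v1 v2 vc.
have leafN v u w : leaf v -> u \in nbrs v -> w \in nbrs v -> u = w.
  by case/andP=> v1 v2; apply/nbr_unique/deg.
have leafB v : leaf v -> c1 \notin nbrs v -> c2 \in nbrs v.
  by case/andP=> v1 v2; apply: leaf_nbr.
have Apr a : a \in A -> [&& a != y, a \notin nbrs y & a \in nbrs x].
  by move/(subsetP sA); rewrite in_priv.
have Bpr b : b \in B -> [&& b != x, b \notin nbrs x & b \in nbrs y].
  by move/(subsetP sB); rewrite in_priv.
have AB a : a \in A -> a \notin B.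
  by move/Apr=> /and3P[_ ay _]; apply/negP=> /Bpr/and3P[_ _]; rewrite (negPf ay).
have leaf_in v : leaf v -> phi v \in A :|: B.
  move=> lv; rewrite inE; have [vc|vc] := boolP (c1 \in nbrs v).
    by case: (inA v lv vc) => ->.
  by case: (inB v lv vc) => -> _; rewrite orbT.
have leaf1 v : leaf v -> (phi v \in nbrs x) = (v \in nbrs c1).
  move=> lv; have [vc|vc] := boolP (c1 \in nbrs v).
    by have [/Apr/and3P[_ _ ->] _] := inA v lv vc; rewrite nbrs_sym vc.
  by have [/Bpr/and3P[_ /negPf-> _] _] := inB v lv vc; rewrite nbrs_sym (negPf vc).
have leaf2 v : leaf v -> (phi v \in nbrs y) = (v \in nbrs c2).
  move=> lv; have [vc|vc] := boolP (c1 \in nbrs v).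
    have [/Apr/and3P[_ /negPf-> _] _] := inA v lv vc; rewrite nbrs_sym.
    by apply/esym/negP=> vc2; have := leafN v _ _ lv vc vc2; move/eqP; rewrite eq_sym (negPf c21).
  by have [/Bpr/and3P[_ _ ->] _] := inB v lv vc; rewrite nbrs_sym leafB.
have leaf_ne v : leaf v -> phi v != x /\ phi v != y.
  move=> lv; have [vc|vc] := boolP (c1 \in nbrs v).
    have [/Apr/and3P[ny _ nx] _] := inA v lv vc; split=> //.
    by apply: contraTneq nx => ->; apply: nbrs_irr.
  have [/Bpr/and3P[nx _ ny] _] := inB v lv vc; split=> //.
  by apply: contraTneq ny => ->; apply: nbrs_irr.
have cases v : [\/ v = c1, v = c2 | leaf v].
  rewrite /leaf; case: (eqVneq v c1) => [->|_]; first by constructor 1.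
  by case: (eqVneq v c2) => [->|_]; [constructor 2 | constructor 3].
have xy_ne : x != y by apply: contraTneq xy => ->; apply: nbrs_irr.
exists phi.
  move=> u v; case: (cases u) => [->|->|lu]; case: (cases v) => [->|->|lv] //;
    rewrite ?phi1 ?phi2 => e.
  - by rewrite e eqxx in xy_ne.
  - by have [] := leaf_ne v lv; rewrite -e eqxx.
  - by rewrite e eqxx in xy_ne.
  - by have [_] := leaf_ne v lv; rewrite -e eqxx.
  - by have [] := leaf_ne u lu; rewrite e eqxx.
  - by have [_] := leaf_ne u lu; rewrite e eqxx.
  have [uc|uc] := boolP (c1 \in nbrs u); have [vc|vc] := boolP (c1 \in nbrs v).
  - by apply: (nthAB A) => //; have [_ <-] := inA u lu uc; have [_ <-] := inA v lv vc.
  - by have [uA _] := inA u lu uc; have [vB _] := inB v lv vc; have := AB _ uA; rewrite e vB.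
  - by have [uB _] := inB u lu uc; have [vA _] := inA v lv vc; have := AB _ vA; rewrite -e uB.
  - by apply: (nthAB B) => //; have [_ <-] := inB u lu uc; have [_ <-] := inB v lv vc.
move=> u v; rewrite -!in_nbrs.
case: (cases u) => [->|->|lu]; case: (cases v) => [->|->|lv]; rewrite ?phi1 ?phi2.
- by rewrite !(negPf (nbrs_irr _)).
- by rewrite xy c12.
- exact: leaf1.
- by rewrite nbrs_sym xy nbrs_sym c12.
- by rewrite !(negPf (nbrs_irr _)).
- exact: leaf2.
- by rewrite nbrs_sym leaf1 // nbrs_sym.
- by rewrite nbrs_sym leaf2 // nbrs_sym.
rewrite nbrs_sym (negPf (st _ _ (leaf_in u lu) (leaf_in v lv))).
apply/esym/negP=> uv; have /andP[v1 v2] := lv.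
have [uc|/(leafB u lu) uc] := boolP (c1 \in nbrs u).
  by rewrite (leafN u _ _ lu uv uc) eqxx in v1.
by rewrite (leafN u _ _ lu uv uc) eqxx in v2.
Qed.

End DoubleStar.

(** * The chromatic number *)

Lemma colours_chromatic (G : sgraph) n : colours [set: G] n -> chromatic_number G <= n.
Proof.
case=> c [c_lt cP]; rewrite /chromatic_number; case: ex_minnP => k _; apply.
apply/existsP; exists [ffun x => Ordinal (c_lt x (in_setT x))].
apply/forallP=> x; apply/forallP=> y; apply/implyP=> xy; rewrite !ffunE -val_eqE /=.
by apply: cP; rewrite ?inE // in_nbrs.
Qed.

Local Open Scope ring_scope.

Theorem mainTheorem1 (H : sgraph) (hH : double_star H) :
  exists f : {poly int}, forall G : sgraph, graph_free H G ->
    (chromatic_number G)%:Z <= f.[(clique_number G)%:Z].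
Proof.
have [[H_conn _] D2] := hH.
have [B [e lossB]] := loss_poly #|H|.
pose f k := (B * k ^ e.+2)%N.
have slack k a b : (0 < k -> a + b <= k -> a < k -> b < k ->
    f a + f b + loss #|H| k <= f k)%N.
  move=> k0 ab ak bk; apply: (@leq_trans (f a + f b + B * k ^ e.+1)%N).
    by rewrite leq_add2l (leq_trans (lossB k k0)) // leq_mul2l leq_pexp2l ?orbT.
  by rewrite /f -!mulnDr leq_mul2l pow_slack ?orbT.
exists (B%:R *: 'X^(e.+2)) => G HG; rewrite hornerZ hornerXn.
have -> : B%:R * (clique_number G)%:Z ^+ e.+2 = (f (clique_number G))%:Z :> int.
  by rewrite /f -!natz natrM natrX.
rewrite lez_nat; apply: colours_chromatic; apply: (colours_all slack).
  exact: free_double_star_free.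
by move=> Q cQ; apply: (@leq_bigmax_cond _ _ (fun S : {set G} => #|S|)).
Qed.
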